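(* $\rho\tau(K_9, o(\mathbf{Q}(3,n))) \le 3/10$. That is, for every $\gamma>0$ there is $\delta>0$ such that every $n$-vertex $K_9$-free graph $G$ with $\alpha(G)\le \delta\,\mathbf{Q}(3,n)$ satisfies $e(G)\le (3/10+\gamma)n^2$ for all sufficiently large $n$.
   Context: For a graph $H$ and a function $f(n)$, the Ramsey–Turán number $\mathbf{RT}(n,H,f(n))$ is the maximum number of edges in an $n$-vertex $H$-free graph with independence number at most $f(n)$. Let $\overline{\rho\tau}(H,f)=\limsup_{n\to\infty}\mathbf{RT}(n,H,f(n))/n^2$ and $\underline{\rho\tau}(H,f)=\liminf_{n\to\infty}\mathbf{RT}(n,H,f(n))/n^2$; when they coincide, their common value is $\rho\tau(H,f)$. Further $\rho\tau(H,o(f)) := \lim_{\delta\to 0}\rho\tau(H,\delta f)$; an upper bound $\rho\tau(H,o(f))\le c$ means $\lim_{\delta\to0}\overline{\rho\tau}(H,\delta f)\le c$. The inverse Ramsey number $\mathbf{Q}(t,n)$ is the minimum independence number of a $K_t$-free graph on $n$ vertices. $\alpha(G)$ is the independence number and $e(G)$ the number of edges of $G$. *)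

(* Defs.v *)
From HB Require Import structures.
From mathcomp Require Import all_boot all_order all_algebra.
From mathcomp Require Import all_classical all_reals all_analysis.

Set Implicit Arguments.
Unset Strict Implicit.
Unset Printing Implicit Defensive.
Import Order.TTheory GRing.Theory Num.Theory.
Import numFieldNormedType.Exports.
Local Open Scope classical_set_scope.
Local Open Scope ring_scope.

(* Edges are 2-element vertex sets, so #|edges G| counts each edge once. *)
Record sgraph (T : finType) := SGraph {
  edges : {set {set T}};
  edges_card2 : [forall e in edges, #|e| == 2%N] }.

HB.instance Definition _ (T : finType) := [isSub for @edges T].
HB.instance Definition _ (T : finType) := [Finite of sgraph T by <:].

Definition adj (T : finType) (G : sgraph T) : rel T :=
  fun x y => [set x; y]%SET \in edges G.

Definition independent (T : finType) (G : sgraph T) (S : {set T}) : bool :=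
  [forall x in S, forall y in S, ~~ adj G x y].

Definition alpha (T : finType) (G : sgraph T) : nat :=
  \max_(S : {set T} | independent G S) #|S|.

(* H-free in the subgraph (not necessarily induced) sense. *)
Definition contains (U T : finType) (H : sgraph U) (G : sgraph T) : bool :=
  [exists h : {ffun U -> T},
     injectiveb h && [forall x, forall y, adj H x y ==> adj G (h x) (h y)]].

Definition graph_free (U T : finType) (H : sgraph U) (G : sgraph T) : bool :=
  ~~ contains H G.

Lemma complete_edges_card2 (T : finType) :
  [forall e in [set e : {set T} | #|e| == 2%N]%SET, #|e| == 2%N].
Proof. by apply/forall_inP => e; rewrite inE. Qed.

Definition complete_graph (t : nat) : sgraph 'I_t :=
  SGraph (complete_edges_card2 'I_t).

(* The default value n is an upper bound of alpha on n vertices, so this is the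
   true minimum whenever some K_t-free graph on n vertices exists (in
   particular for every t >= 2). *)
Definition inverse_ramsey (t n : nat) : nat :=
  \big[minn/n]_(G : sgraph 'I_n | graph_free (complete_graph t) G) alpha G.

(* Equal to 0 when no graph satisfies the constraints. *)
Definition ramsey_turan {R : realType} (U : finType) (n : nat) (H : sgraph U)
    (a : R) : nat :=
  \max_(G : sgraph 'I_n | graph_free H G && ((alpha G)%:R <= a)) #|edges G|.

Definition rho_tau_upper {R : realType} (U : finType) (H : sgraph U)
    (f : nat -> R) : \bar R :=
  limn_esup (fun n => ((ramsey_turan n H (f n))%:R / n%:R ^+ 2)%:E).

(* The limit as d tends to 0 through positive values exists and is at most c;
   a bare bound on [lim] would be meaningless if the limit did not exist. *)
Definition rho_tau_o_le {R : realType} (U : finType) (H : sgraph U)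
    (f : nat -> R) (c : R) : Prop :=
  exists2 l : \bar R,
    rho_tau_upper H (fun n => d * f n) @[d --> 0^'+] --> l & (l <= c%:E)%E.

(* Main.v *)
Require Import Defs.
From mathcomp Require Import all_boot all_order all_algebra.
From mathcomp Require Import ring lra zify.

(* Since Q(3, n) is at most k Q(3, n / k) (take k disjoint copies), a graph with
   independence number o(Q(3, n)) has a triangle inside every linear-sized set
   of vertices; it has an edge inside every set of size n^(7/8), because
   Q(3, n) = O(n^(3/4)).

   Let G be such a graph without K9.  Dependent random choice turns any positive
   proportion of K4's into a K9 = K3 + K2 + K2 + K2, so G has o(n^4) copies of
   K4.  Apply Szemeredi's regularity lemma.  By counting, the reduced graph has
   no K4 (nor loops, which would also give many K4's).  Three pairwise regular
   parts with densities above 2/3 contain K9 = K3 + K3 + K3: the vertices of a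
   triangle in a part have a linear common neighbourhood in the two others.  So
   every triangle of the reduced graph has an edge of density at most 2/3, and a
   weighted Turan theorem (Motzkin-Straus) bounds the edge density: the extremal
   weights (2/3, 1, 1) on parts of size 3/10, 3/10 and 4/10 give 3/10. *)

Set Implicit Arguments.
Unset Strict Implicit.
Unset Printing Implicit Defensive.
Import Order.TTheory GRing.Theory Num.Theory.
Local Open Scope ring_scope.

(** * Regularity lemma *)

Section Density.
Variables (R : realFieldType) (V : finType) (f : V -> V -> R).
Implicit Types (X Y A B : {set V}).

Definition weight X Y : R := \sum_(x in X) \sum_(y in Y) f x y.

Definition density X Y : R := weight X Y / (#|X|%:R * #|Y|%:R).

(* Only the lower half of eps-regularity is needed, and A = B is allowed. *)
Definition lower_regular (eps : R) A B : bool :=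
  [forall X : {set V}, forall Y : {set V},
     [&& X \subset A, Y \subset B, eps * #|A|%:R <= #|X|%:R
       & eps * #|B|%:R <= #|Y|%:R] ==>
     ((density A B - eps) * (#|X|%:R * #|Y|%:R) <= weight X Y)].

Lemma sum_const_set X Y (k : R) :
  \sum_(x in X) \sum_(y in Y) k = k * (#|X|%:R * #|Y|%:R).
Proof.
by under eq_bigr do rewrite sumr_const -mulr_natr; rewrite sumr_const -mulr_natr; ring.
Qed.

Hypothesis f01 : forall x y, 0 <= f x y <= 1.

Lemma weight_ge0 X Y : 0 <= weight X Y.
Proof. by apply: sumr_ge0 => x _; apply: sumr_ge0 => y _; case/andP: (f01 x y). Qed.

Lemma weight_le X Y : weight X Y <= #|X|%:R * #|Y|%:R.
Proof.
rewrite -[leRHS]mul1r -sum_const_set.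
by apply: ler_sum => x _; apply: ler_sum => y _; case/andP: (f01 x y).
Qed.

Lemma weightE X Y : density X Y * (#|X|%:R * #|Y|%:R) = weight X Y.
Proof.
have [z|nz] := eqVneq (#|X|%:R * #|Y|%:R : R) 0; last by rewrite divfK.
(* With an empty side the product of sizes is [0], and the weight is squeezed between [0] and that
   product. *)
by rewrite z mulr0; apply/eqP; rewrite eq_le weight_ge0 -z weight_le.
Qed.

Lemma density_ge0 X Y : 0 <= density X Y.
Proof. by rewrite divr_ge0 ?weight_ge0 ?mulr_ge0. Qed.

Lemma density_le1 X Y : density X Y <= 1.
Proof.
have [z|nz] := eqVneq (#|X|%:R * #|Y|%:R : R) 0; first by rewrite /density z invr0 mulr0.
by rewrite ler_pdivrMr ?mul1r ?weight_le // lt_def nz mulr_ge0.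
Qed.

End Density.

Section Regularity.
Variables (R : realFieldType) (V : finType) (f : V -> V -> R).
Hypothesis f01 : forall x y, 0 <= f x y <= 1.

Section Colouring.
Variables (C : finType) (c : V -> C).

Definition part (a : C) : {set V} := [set v | c v == a].

Lemma sum_part (F : V -> V -> R) :
  \sum_x \sum_y F x y =
  \sum_a \sum_b \sum_(x in part a) \sum_(y in part b) F x y.
Proof.
rewrite (partition_big c predT) //=; apply: eq_bigr => a _.
rewrite exchange_big /= (partition_big c predT) //=; apply: eq_bigr => b _.
rewrite exchange_big /=; apply: eq_big => [x|x _]; first by rewrite inE.
by apply: eq_bigl => y; rewrite inE.
Qed.

Lemma sum_card_part : \sum_a #|part a|%:R = #|V|%:R :> R.
Proof.
rewrite -natr_sum -sum1_card (partition_big c predT) //=; congr _%:R.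
by apply: eq_bigr => a _; rewrite sum1dep_card.
Qed.

Definition block_density (x y : V) : R := density f (part (c x)) (part (c y)).

(** Block averaging preserves sums over each pair of blocks, hence integrals against functions
    constant on blocks: [block_density] is the conditional expectation of [f]. *)
Lemma block_density_sum (H : C -> C -> R) :
  \sum_x \sum_y block_density x y * H (c x) (c y) = \sum_x \sum_y f x y * H (c x) (c y).
Proof.
rewrite !sum_part; apply: eq_bigr => a _; apply: eq_bigr => b _.
transitivity (density f (part a) (part b) * H a b * (#|part a|%:R * #|part b|%:R)).
  rewrite -sum_const_set; apply: eq_bigr => x; rewrite inE => /eqP xa.
  by apply: eq_bigr => y; rewrite inE => /eqP yb; rewrite /block_density xa yb.
rewrite mulrAC weightE // /weight mulr_suml; apply: eq_bigr => x; rewrite inE => /eqP xa.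
by rewrite mulr_suml; apply: eq_bigr => y; rewrite inE => /eqP yb; rewrite xa yb.
Qed.

Definition energy : R := \sum_x \sum_y block_density x y ^+ 2.

Lemma energy_ge0 : 0 <= energy.
Proof. by apply: sumr_ge0 => x _; apply: sumr_ge0 => y _; rewrite sqr_ge0. Qed.

Lemma energy_le : energy <= #|V|%:R ^+ 2.
Proof.
rewrite expr2 -[leRHS]mul1r -cardsT -sum_const_set /=.
rewrite [leRHS](eq_bigl predT) => [|x]; last by rewrite inE.
apply: ler_sum => x _; rewrite [leRHS](eq_bigl predT) => [|y]; last by rewrite inE.
by apply: ler_sum => y _; rewrite expr_le1 ?density_ge0 ?density_le1.
Qed.

End Colouring.

(* Pythagoras: the densities over the coarse partition are the orthogonal
   projection of the densities over the fine one. *)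
Lemma energy_refine (C C' : finType) (c : V -> C) (c' : V -> C') (h : C' -> C) :
  (forall v, c v = h (c' v)) ->
  energy c' - energy c = \sum_x \sum_y (block_density c' x y - block_density c x y) ^+ 2.
Proof.
move=> hc.
pose D a b := density f (part c (h a)) (part c (h b)).
have avgD x y : block_density c x y = D (c' x) (c' y) by rewrite /block_density /D !hc.
(* The cross term: tested against a function constant on coarse blocks, the fine averages may be
   replaced by [f], and [f] by the coarse averages. *)
have E1 : \sum_x \sum_y block_density c' x y * block_density c x y = energy c.
  have -> : \sum_x \sum_y block_density c' x y * block_density c x y =
            \sum_x \sum_y f x y * block_density c x y.
    transitivity (\sum_x \sum_y block_density c' x y * D (c' x) (c' y)).
      by apply: eq_bigr => x _; apply: eq_bigr => y _; rewrite avgD.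
    by rewrite block_density_sum; apply: eq_bigr => x _; apply: eq_bigr => y _; rewrite avgD.
  rewrite -(block_density_sum c (fun a b => density f (part c a) (part c b))).
  by apply: eq_bigr => x _; apply: eq_bigr => y _; rewrite expr2.
transitivity (energy c' - (energy c) *+ 2 + energy c); first by ring.
rewrite -{1}E1 -sumrMnl -sumrB -big_split /=; apply: eq_bigr => x _.
rewrite -sumrMnl -sumrB -big_split /=; apply: eq_bigr => y _; ring.
Qed.

Lemma sum_subset (X A Y B : {set V}) (F : V -> V -> R) :
  X \subset A -> Y \subset B -> (forall x y, 0 <= F x y) ->
  \sum_(x in X) \sum_(y in Y) F x y <= \sum_(x in A) \sum_(y in B) F x y.
Proof.
move=> XA YB F0; rewrite [leRHS](big_setID X) /= (setIidPr XA) -[leLHS]addr0.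
apply: lerD; last by apply: sumr_ge0 => x _; apply: sumr_ge0 => y _.
apply: ler_sum => x _; rewrite [leRHS](big_setID Y) /= (setIidPr YB) -[leLHS]addr0.
by rewrite lerD2l; apply: sumr_ge0 => y _.
Qed.

Definition irregular (eps : R) (C : finType) (c : V -> C) : R :=
  \sum_a \sum_(b | ~~ lower_regular f eps (part c a) (part c b))
     #|part c a|%:R * #|part c b|%:R.

(** Each irregular pair of parts has a witness pair of subsets. Cutting every part along all
    witnesses makes each witness box a union of new boxes; there the new densities fall short of the
    old one by more than [eps] on average, on at least a fraction [eps ^+ 2] of the pair. Squaring
    gives [eps ^+ 4]. *)
Lemma energy_increment (eps : R) (C : finType) (c : V -> C) : 0 < eps ->
  exists c' : V -> C * {set C} * {set C},
    energy c + eps ^+ 4 * irregular eps c <= energy c'.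
Proof.
move=> eps0.
pose P a b (XY : {set V} * {set V}) :=
  [&& XY.1 \subset part c a, XY.2 \subset part c b,
      eps * #|part c a|%:R <= #|XY.1|%:R, eps * #|part c b|%:R <= #|XY.2|%:R
    & weight f XY.1 XY.2 <
        (density f (part c a) (part c b) - eps) * (#|XY.1|%:R * #|XY.2|%:R)].
pose W a b := odflt (set0, set0) (pick (P a b)).
have WP a b : ~~ lower_regular f eps (part c a) (part c b) -> P a b (W a b).
  rewrite /lower_regular negb_forall => /existsP[X]; rewrite negb_forall => /existsP[Y].
  rewrite negb_imply -ltNge => /andP[/and4P[h1 h2 h3 h4] h5].
  rewrite /W; case: pickP => [//|/(_ (X, Y))]; rewrite /P /= h1 h2 h3 h4 h5.
  by [].
pose X a b := (W a b).1; pose Y a b := (W a b).2.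
(* The new colour keeps the old one and records which witnesses contain [v], as first side and as
   second side. *)
pose c' v : C * {set C} * {set C} :=
  (c v, [set b | v \in X (c v) b], [set a | v \in Y a (c v)]).
exists c'.
rewrite -lerBrDl (@energy_refine _ _ c c' (fun p => p.1.1)) // (sum_part c).
rewrite /irregular mulr_sumr; apply: ler_sum => a _.
rewrite mulr_sumr big_mkcond /=; apply: ler_sum => b _.
case: ifPn => [bad|_]; last first.
  by apply: sumr_ge0 => x _; apply: sumr_ge0 => y _; rewrite sqr_ge0.
have /and5P[XA YB XS YS dXY] := WP _ _ bad.
rewrite -/(X a b) -/(Y a b) in XA YB XS YS dXY.
set A := part c a in XA XS dXY *; set B := part c b in YB YS dXY *.
pose D x y := block_density c' x y - block_density c x y.
have SD : \sum_(x in X a b) \sum_(y in Y a b) D x y =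
          weight f (X a b) (Y a b) - density f A B * (#|X a b|%:R * #|Y a b|%:R).
  rewrite /D; under eq_bigr do rewrite sumrB.
  rewrite sumrB; congr (_ - _); last first.
    rewrite -sum_const_set; apply: eq_bigr => x /(subsetP XA); rewrite inE => /eqP xa.
    by apply: eq_bigr => y /(subsetP YB); rewrite inE => /eqP yb; rewrite /block_density xa yb.
  (* [H] is the indicator of the witness box, read off from the new colours alone, so that
     [block_density_sum] applies. *)
  pose H (p q : C * {set C} * {set C}) : R :=
    ((p.1.1 == a) && (b \in p.1.2))%:R * ((q.1.1 == b) && (a \in q.2))%:R.
  have HE F : \sum_(x in X a b) \sum_(y in Y a b) F x y =
      \sum_x \sum_y F x y * H (c' x) (c' y) :> R.
    rewrite [LHS]big_mkcond /=; apply: eq_bigr => x _.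
    have -> : (x \in X a b) = (c x == a) && (b \in (c' x).1.2).
      rewrite inE; case: eqP => [->//|nxa] /=; apply/negP => /(subsetP XA).
      by rewrite inE => /eqP.
    rewrite /H /=; case: ifP => _; last by rewrite big1 // => y _; rewrite mul0r mulr0.
    rewrite [LHS]big_mkcond /=; apply: eq_bigr => y _.
    have -> : (y \in Y a b) = (c y == b) && (a \in (c' y).2).
      rewrite inE; case: eqP => [->//|nyb] /=; apply/negP => /(subsetP YB).
      by rewrite inE => /eqP.
    by case: ifP => _; rewrite ?mulr1n ?mul1r ?mulr1 ?mulr0.
  by rewrite /weight !HE block_density_sum.
apply: le_trans (sum_subset (F := fun x y => D x y ^+ 2) XA YB _); last first.
  by move=> x y; rewrite sqr_ge0.
(* D^2 >= - 2 eps D - eps^2 *)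
have : \sum_(x in X a b) \sum_(y in Y a b) (- (2 * eps) * D x y - eps ^+ 2) <=
       \sum_(x in X a b) \sum_(y in Y a b) D x y ^+ 2.
  apply: ler_sum => x _; apply: ler_sum => y _.
  by have := sqr_ge0 (D x y + eps); lra.
apply: le_trans; under eq_bigr do rewrite sumrB -mulr_sumr.
rewrite sumrB -mulr_sumr SD sum_const_set.
(* The deficit of the witness gives at least [2 * eps ^+ 2 * q - eps ^+ 2 * q], and [q] is at least
   [eps ^+ 2 * q']. *)
have sq : eps ^+ 2 * (#|A|%:R * #|B|%:R) <= #|X a b|%:R * #|Y a b|%:R.
  have -> : eps ^+ 2 * (#|A|%:R * #|B|%:R) = eps * #|A|%:R * (eps * #|B|%:R) by ring.
  by apply: ler_pM => //; rewrite mulr_ge0 // ltW.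
set q := #|X a b|%:R * #|Y a b|%:R in sq dXY *; set q' := #|A|%:R * #|B|%:R in sq *.
have e2 : 0 < eps ^+ 2 by rewrite exprn_gt0.
have := ler_wpM2l (ltW e2) sq.
move/ltW/(ler_wpM2l (ltW eps0)): dXY => /= dXY h.
lra.
Qed.

(** The recursion follows the cardinality of [C * {set C} * {set C}], the colours after one
    refinement. *)
Fixpoint tower (i : nat) : nat :=
  if i is i'.+1 then (tower i' * 2 ^ tower i' * 2 ^ tower i')%N else 1%N.

(** A round that starts from an irregular mass above [eps * #|V| ^ 2] gains [eps ^+ 5 * #|V| ^ 2] of
    energy. *)
Lemma regularity_iter (eps : R) (i : nat) : 0 < eps ->
  exists (C : finType) (c : V -> C), (#|C| <= tower i)%N /\
    (irregular eps c <= eps * #|V|%:R ^+ 2 \/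
     i%:R * eps ^+ 5 * #|V|%:R ^+ 2 <= energy c).
Proof.
move=> eps0; elim: i => [|i [C [c [cardC [reg|en]]]]].
- exists unit, (fun=> tt); split; first by rewrite card_unit.
  by right; rewrite !mul0r energy_ge0.
- exists C, c; split; last by left.
  by apply: leq_trans cardC _ => /=; rewrite -mulnA leq_pmulr // muln_gt0 !expn_gt0.
have [reg|irr] := leP (irregular eps c) (eps * #|V|%:R ^+ 2).
  exists C, c; split; last by left.
  by apply: leq_trans cardC _ => /=; rewrite -mulnA leq_pmulr // muln_gt0 !expn_gt0.
have [c' en'] := energy_increment c eps0.
exists (C * {set C} * {set C})%type, c'; split.
  rewrite !card_prod -!cardsT -!powersetT !card_powerset !cardsT /=.
  by rewrite !leq_mul // leq_exp2l.
right; apply: le_trans en'.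
have e4 : 0 < eps ^+ 4 by rewrite exprn_gt0.
have := ler_wpM2l (ltW e4) (ltW irr).
rewrite -natr1; set n2 := #|V|%:R ^+ 2 in en *; set x := irregular _ _ in irr *.
have -> : (i%:R + 1) * eps ^+ 5 * n2 = i%:R * eps ^+ 5 * n2 + eps ^+ 4 * (eps * n2) by ring.
by lra.
Qed.

End Regularity.

(** The energy never exceeds [#|V| ^ 2], so more than [eps ^- 5] gaining rounds are impossible; the
    number of colours is thus bounded in terms of [eps] only. *)
Lemma regularity (R : archiRealFieldType) (eps : R) : 0 < eps ->
  exists K : nat, forall (V : finType) (f : V -> V -> R),
    (forall x y, 0 <= f x y <= 1) ->
    exists (C : finType) (c : V -> C),
      (#|C| <= K)%N /\ irregular f eps c <= eps * #|V|%:R ^+ 2.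
Proof.
move=> eps0; have e5 : 0 < eps ^+ 5 by rewrite exprn_gt0.
pose i := Num.bound (eps ^- 5); exists (tower i) => V f f01.
have [C [c [cardC [reg|en]]]] := regularity_iter f01 i eps0; first by exists C, c.
exists C, c; split=> //.
have := le_trans en (energy_le f01 c).
have ie : 1 < i%:R * eps ^+ 5.
  have := archi_boundP (ltW (_ : 0 < eps ^- 5)); rewrite invr_gt0 => /(_ e5).
  by rewrite -/i -[X in X < _]mul1r ltr_pdivrMr.
have [n0|n0] := eqVneq (#|V|%:R : R) 0; last first.
  have n2 : 0 < #|V|%:R ^+ 2 :> R by rewrite exprn_even_gt0.
  by rewrite -[leRHS]mul1r ler_pM2r // leNgt ie.
(* For empty [V] the energy bound is no contradiction, but the irregular mass vanishes. *)
move=> _; rewrite n0 expr0n mulr0 /irregular big1 // => a _; rewrite big1 // => b _.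
move/eqP: n0; rewrite pnatr_eq0 => /eqP n0.
suff -> : #|part c a| = 0%N by rewrite mul0r.
by apply/eqP; rewrite -leqn0 -n0 max_card.
Qed.

(** * Weighted Turan theorem *)

Section WeightedTuran.
Variables (R : realFieldType) (C : finType) (w : C -> C -> R) (eta : R).
Hypothesis eta0 : 0 <= eta.
Hypothesis wC : forall a b, w a b = w b a.
Hypothesis waa : forall a, w a a = 0.
Hypothesis w01 : forall a b, 0 <= w a b <= 1.
Hypothesis noK4 : forall a b c d,
  ~~ [&& 0 < w a b, 0 < w a c, 0 < w a d, 0 < w b c, 0 < w b d & 0 < w c d].
Hypothesis triangle : forall a b c, 0 < w a b -> 0 < w a c -> 0 < w b c ->
  [|| w a b <= 2 / 3 + eta, w a c <= 2 / 3 + eta | w b c <= 2 / 3 + eta].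

Definition quad (x : C -> R) : R := \sum_a \sum_b w a b * x a * x b.

(* Moving weight between two non-adjacent points changes the form linearly, so
   one of the two points can be emptied; repeat until the support is a clique. *)
Lemma quad_shift (x : C -> R) (a b : C) (s : R) : a != b -> w a b = 0 ->
  quad (fun c => x c + s * ((c == a)%:R - (c == b)%:R)) =
  quad x + 2 * s * (\sum_c w a c * x c - \sum_c w b c * x c).
Proof.
move=> ab wab.
pose D c : R := (c == a)%:R - (c == b)%:R.
have sumD (F : C -> R) : \sum_c D c * F c = F a - F b.
  rewrite /D; under eq_bigr do rewrite mulrBl.
  rewrite sumrB; congr (_ - _).
    by rewrite (bigD1 a) //= eqxx mul1r big1 ?addr0 // => c /negPf->; rewrite mul0r.
  by rewrite (bigD1 b) //= eqxx mul1r big1 ?addr0 // => c /negPf->; rewrite mul0r.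
have E : quad (fun c => x c + s * D c) = quad x
   + s * (\sum_c D c * (\sum_d w c d * x d))
   + s * (\sum_c D c * (\sum_d w c d * x d))
   + s ^+ 2 * (\sum_c D c * (\sum_d D d * w c d)).
  have T : \sum_c D c * (\sum_d w c d * x d) = \sum_c x c * (\sum_d w c d * D d).
    under eq_bigr do rewrite mulr_sumr.
    under [RHS]eq_bigr do rewrite mulr_sumr.
    rewrite exchange_big /=; apply: eq_bigr => c _; apply: eq_bigr => d _.
    by rewrite (wC d c); ring.
  rewrite {2}T /quad !mulr_sumr -!big_split /=; apply: eq_bigr => c _.
  rewrite !mulr_sumr -!big_split /=; apply: eq_bigr => d _; ring.
rewrite -[LHS]/(quad (fun c => x c + s * D c)) E !sumD !waa wab wC wab; ring.
Qed.

Lemma quad_support (x : C -> R) (S : {set C}) : (forall c, c \notin S -> x c = 0) ->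
  quad x = \sum_(a <- enum S) \sum_(b <- enum S) w a b * x a * x b.
Proof.
move=> xS; rewrite big_enum /= [RHS]big_mkcond; apply: eq_bigr => a _.
case: ifPn => [aS|/xS->]; last by rewrite big1 // => b _; ring.
rewrite big_enum [RHS]big_mkcond; apply: eq_bigr => b _.
by case: ifPn => // /xS->; ring.
Qed.

(* At p = 2/3, q = r = 1 and eta = 0 the right side minus the left side is
   (3/5) (z - (2/3) (x + y))^2 + (1/3) (x - y)^2. *)
Lemma three_weights (p q r x y z : R) : 0 <= x -> 0 <= y -> 0 <= z ->
  p <= 2 / 3 + eta -> q <= 1 -> r <= 1 ->
  2 * (p * (x * y) + q * (x * z) + r * (y * z)) <=
  (3 / 5 + 2 * eta) * (x + y + z) ^+ 2.
Proof.
move=> x0 y0 z0 hp hq hr.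
have xy := mulr_ge0 x0 y0; have xz := mulr_ge0 x0 z0; have yz := mulr_ge0 y0 z0.
have h1 := ler_wpM2r xy hp; have h2 := ler_wpM2r xz hq; have h3 := ler_wpM2r yz hr.
have h4 := sqr_ge0 (z - 2 / 3 * (x + y)); have h5 := sqr_ge0 (x - y).
have h6 : 0 <= eta * ((x + y + z) ^+ 2 - x * y).
  by apply: mulr_ge0 => //; nra.
by nra.
Qed.

(** Induction on the size of the support. Two support points with [w a b = 0] are merged by
    [quad_shift]. Otherwise the support is a clique, of at most three points by [noK4], and
    [three_weights] handles the triangle. *)
Lemma weighted_turan (x : C -> R) : (forall c, 0 <= x c) ->
  quad x <= (3 / 5 + 2 * eta) * (\sum_c x c) ^+ 2.
Proof.
have [n] := ubnP #|[set c | x c != 0]|; elim: n x => // n IH x.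
set S := [set c | x c != 0] => ltS x0.
have [/existsP[a /existsP[b /and4P[aS bS ab /eqP wab]]]|clq] :=
  boolP [exists a, exists b, [&& a \in S, b \in S, a != b & w a b == 0]].
  wlog le_ba : a b aS bS ab wab / \sum_c w b c * x c <= \sum_c w a c * x c.
    move=> wl; have [h|/ltW h] := leP (\sum_c w b c * x c) (\sum_c w a c * x c).
      exact: (wl a b).
    by apply: (wl b a) => //; rewrite 1?eq_sym // wC.
  (* All the weight of [b] goes to [a]. The total is unchanged, the form does not decrease by
     [le_ba], and [b] leaves the support. *)
  pose y c := x c + x b * ((c == a)%:R - (c == b)%:R).
  have yb : y b = 0 by rewrite /y eqxx eq_sym (negPf ab) /=; ring.
  have y0 c : 0 <= y c.
    have [->|cb] := eqVneq c b; first by rewrite yb.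
    by rewrite /y (negPf cb) subr0 addr_ge0 // mulr_ge0.
  have sy : \sum_c y c = \sum_c x c.
    rewrite big_split /= -mulr_sumr sumrB.
    have one d : \sum_c ((c == d)%:R : R) = 1.
      by rewrite (bigD1 d) //= eqxx big1 ?addr0 // => c /negPf->.
    by rewrite !one subrr mulr0 addr0.
  rewrite -sy; apply: le_trans (IH y _ y0); last first.
    rewrite -ltnS; apply: leq_trans ltS; rewrite ltnS; apply: proper_card.
    apply/properP; split; last by exists b => //; rewrite inE yb eqxx.
    apply/subsetP => c; rewrite !inE; apply: contraNN => /eqP xc.
    have ca : c != a by apply: contraTneq aS => <-; rewrite inE xc eqxx.
    have cb : c != b by apply: contraTneq bS => <-; rewrite inE xc eqxx.
    by rewrite /y (negPf ca) (negPf cb) xc /=; apply/eqP; ring.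
  rewrite quad_shift // lerDl mulr_ge0 ?subr_ge0 //.
  by rewrite mulr_ge0.
have wpos a b : a \in S -> b \in S -> a != b -> 0 < w a b.
  move=> aS bS ab; rewrite lt_def; case/andP: (w01 a b) => -> _; rewrite andbT.
  move: clq; rewrite negb_exists => /forallP/(_ a).
  by rewrite negb_exists => /forallP/(_ b); rewrite aS bS ab.
have xS c : c \notin S -> x c = 0 by rewrite inE negbK => /eqP.
have -> : \sum_c x c = \sum_(c <- enum S) x c.
  rewrite big_enum [RHS]big_mkcond; apply: eq_bigr => c _.
  by case: ifPn => // /xS.
rewrite (quad_support xS).
have w1 a b : w a b <= 1 by case/andP: (w01 a b).
have eS c : c \in enum S -> c \in S by rewrite mem_enum.
case: (enum S) (enum_uniq S) eS => [|a [|b [|c [|d l]]]] /= uS eS.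
- by rewrite !big_nil expr0n mulr0.
- rewrite !big_seq1 waa !mul0r mulr_ge0 ?sqr_ge0 //; have := eta0; lra.
- have := w1 a b; have := x0 a; have := x0 b; have := eta0.
  rewrite !big_cons !big_nil !waa (wC b a) => e0 xb xa w1ab.
  have := ler_wpM2r (mulr_ge0 xa xb) w1ab.
  have := sqr_ge0 (x a - x b); have := mulr_ge0 e0 (sqr_ge0 (x a + x b)).
  have := mulr_ge0 xa xb; lra.
- have [ab [ac bc]] : a != b /\ a != c /\ b != c.
    by move: uS; rewrite !inE !negb_or -!andbA => /and4P[-> -> ->].
  have aS : a \in S by apply: eS; rewrite !inE eqxx.
  have bS : b \in S by apply: eS; rewrite !inE eqxx orbT.
  have cS : c \in S by apply: eS; rewrite !inE eqxx !orbT.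
  rewrite !big_cons !big_nil !waa (wC b a) (wC c a) (wC c b).
  set s := _ ^+ 2.
  case/or3P: (triangle (wpos _ _ aS bS ab) (wpos _ _ aS cS ac) (wpos _ _ bS cS bc)) => h.
  + have := three_weights (x0 a) (x0 b) (x0 c) h (w1 a c) (w1 b c).
    by rewrite /s; lra.
  + have := three_weights (x0 a) (x0 c) (x0 b) h (w1 a b) (w1 b c).
    by rewrite /s; lra.
  + have := three_weights (x0 b) (x0 c) (x0 a) h (w1 a b) (w1 a c).
    by rewrite /s; lra.
- move: uS; rewrite !inE !negb_or -!andbA => /and5P[ab ac ad _ /and4P[bc bd _ /and3P[cd _ _]]].
  have aS : a \in S by apply: eS; rewrite !inE eqxx.
  have bS : b \in S by apply: eS; rewrite !inE eqxx orbT.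
  have cS : c \in S by apply: eS; rewrite !inE eqxx !orbT.
  have dS : d \in S by apply: eS; rewrite !inE eqxx !orbT.
  by case/negP: (noK4 a b c d); rewrite !wpos.
Qed.

End WeightedTuran.

(** * Cliques and dependent random choice *)

Lemma natr_card (R : pzSemiRingType) (T : finType) (A : {pred T}) :
  #|A|%:R = \sum_x (x \in A)%:R :> R.
Proof. by rewrite -sum1_card natr_sum big_mkcond; apply: eq_bigr => x _; case: (x \in A). Qed.

Section Cliques.
Variables (V : finType) (e : rel V).
Hypotheses (eC : symmetric e) (eI : irreflexive e).
Implicit Types K L : {set V}.

Definition cliques (r : nat) : {set {set V}} :=
  [set K : {set V} | (#|K| == r) &&
     [forall x in K, forall y in K, (x != y) ==> e x y]].

Lemma cliquesP r K :
  reflect (#|K| = r /\ {in K &, forall x y, x != y -> e x y}) (K \in cliques r).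
Proof.
rewrite inE; apply: (iffP andP) => [[/eqP -> /forall_inP h]|[-> h]]; split=> //.
  by move=> x y /h /forall_inP h' /h' /implyP.
apply/forall_inP => x xK; apply/forall_inP => y yK; apply/implyP; exact: h.
Qed.

Lemma cliques_join r s K L : K \in cliques r -> L \in cliques s ->
  {in K & L, forall x y, e x y} -> K :|: L \in cliques (r + s).
Proof.
move=> /cliquesP[cK hK] /cliquesP[cL hL] KL; apply/cliquesP; split.
  rewrite cardsU cK cL (_ : K :&: L = set0) ?cards0 ?subn0 //.
  by apply/setP => x; rewrite !inE; apply/andP => -[xK xL]; have := KL _ _ xK xL; rewrite eI.
move=> x y; rewrite !inE => /orP[xK|xL] /orP[yK|yL] xy.
- exact: hK.
- exact: KL.
- by rewrite eC KL.
- exact: hL.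
Qed.

Lemma card_cliques r : (#|cliques r| <= #|V| ^ r)%N.
Proof.
apply: (@leq_trans #|[set K : {set V} | #|K| == r]|).
  by apply: subset_leq_card; apply/subsetP => K; rewrite !inE => /andP[].
rewrite card_draws; apply: (@leq_trans ('C(#|V|, r) * r`!)%N).
  by rewrite leq_pmulr ?fact_gt0.
rewrite bin_ffact; elim: r (#|V|) => [|r IH] n; first by rewrite ffactn0.
rewrite ffactnS expnS leq_mul // (leq_trans (IH _)) //.
by case: r {IH} => // r; rewrite leq_exp2r ?leq_pred.
Qed.

Lemma cliques_nonempty r K : (0 < r)%N -> K \in cliques r -> exists x, x \in K.
Proof. by move=> r0 /cliquesP[cK _]; apply/card_gt0P; rewrite cK. Qed.

End Cliques.

Section DependentRandomChoice.
Variable R : realFieldType.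

(** The tangent at [p] lies below a convex power. In the induction step the difference is
    [(t + 1) * p ^+ t * (x - p) ^+ 2]. *)
Lemma power_tangent (x p : R) t : 0 <= x -> 0 <= p ->
  p ^+ t.+1 + t.+1%:R * p ^+ t * (x - p) <= x ^+ t.+1.
Proof.
move=> x0 p0; elim: t => [|t IH]; first by rewrite !expr1 expr0; lra.
have h1 := ler_wpM2l x0 IH.
have h2 : 0 <= t.+1%:R * p ^+ t * (x - p) ^+ 2.
  by rewrite mulr_ge0 ?sqr_ge0 // mulr_ge0 ?exprn_ge0 ?ler0n.
rewrite [x ^+ t.+2]exprS; apply: le_trans h1.
rewrite -subr_ge0; apply: le_trans h2 _.
rewrite -(natr1 t.+1) !(exprS p); lra.
Qed.

(** Sum the tangent inequalities at [p]; the linear terms have a nonnegative sum. *)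
Lemma power_mean (I : finType) (x : I -> R) (p : R) t : (forall i, 0 <= x i) ->
  0 <= p -> #|I|%:R * p <= \sum_i x i -> #|I|%:R * p ^+ t <= \sum_i x i ^+ t.
Proof.
move=> x0 p0 h; case: t => [|t].
  by under eq_bigr do rewrite expr0; rewrite expr0 sumr_const mulr_natl.
apply: le_trans (ler_sum _ (fun i _ => power_tangent t (x0 i) p0)).
rewrite big_split /= sumr_const -mulr_sumr sumrB sumr_const.
rewrite -[X in _ <= X + _]mulr_natl -[X in _ - X]mulr_natl.
by rewrite lerDl mulr_ge0 ?subr_ge0 // mulr_ge0 ?exprn_ge0.
Qed.

Variables (V W : finType) (N : V -> {set W}).

Definition common (K : {set V}) : {set W} := [set w | [forall v in K, w \in N v]].

(** Alteration: delete from [U] one vertex of each member of [F] inside [U]. The rest contains no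
    member of [F], so it has fewer than [m] vertices. *)
Lemma card_le_hitting (F : {set {set V}}) (m : R) (U : {set V}) : set0 \notin F ->
  (forall U : {set V}, m <= #|U|%:R -> exists2 K, K \in F & K \subset U) ->
  #|U|%:R <= m + #|[set K in F | K \subset U]|%:R.
Proof.
move=> F0 big; set FU := [set K in F | _].
pose p (K : {set V}) := [pick v in K].
pose H := [set v | Some v \in p @: FU].
have cH : (#|H| <= #|FU|)%N.
  apply: leq_trans (leq_imset_card p FU).
  rewrite -(card_imset H (@Some_inj _)); apply: subset_leq_card.
  by apply/subsetP => _ /imsetP[v vH ->]; rewrite inE in vH.
have cU : #|U :\: H|%:R < m.
  rewrite ltNge; apply/negP => /big[K KF /subsetP KU].
  have KFU : K \in FU.
    by rewrite inE KF; apply/subsetP => v /KU; rewrite inE => /andP[].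
  have : p K \in p @: FU by apply: imset_f.
  rewrite /p; case: pickP => [v vK vH|K0].
    by have := KU _ vK; rewrite inE inE vH.
  by move: F0; rewrite (_ : set0 = K) ?KF //; apply/setP => v; rewrite inE K0.
have : (#|U| <= #|U :\: H| + #|FU|)%N.
  rewrite -(cardsID H U) addnC leq_add2l (leq_trans _ cH) //.
  by rewrite subset_leq_card // subsetIr.
by rewrite -(ler_nat R) natrD; lra.
Qed.

(* Average over all t-tuples of elements of W the number of vertices of V
   adjacent to the whole tuple, minus the number of members of F inside. *)
Lemma dependent_random_choice (F : {set {set V}}) (m b : R) t : set0 \notin F ->
  (forall U : {set V}, m <= #|U|%:R -> exists2 K, K \in F & K \subset U) ->
  0 <= b -> {in F, forall K, #|common K|%:R <= b} ->
  \sum_v #|N v|%:R ^+ t <= m * #|W|%:R ^+ t + #|F|%:R * b ^+ t.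
Proof.
move=> F0 big b0 small.
pose U (g : {ffun 'I_t -> W}) := [set v | [forall i, g i \in N v]].
have cnt (S : {set W}) : #|S|%:R ^+ t = \sum_(g : {ffun 'I_t -> W}) [forall i, g i \in S]%:R :> R.
  rewrite -natrX -{1}(card_ord t) -card_ffun_on natr_card; apply: eq_bigr => g _.
  suff -> : (g \in ffun_on (mem S)) = [forall i, g i \in S] by [].
  by apply/ffun_onP/forallP.
have E1 : \sum_v #|N v|%:R ^+ t = \sum_g #|U g|%:R :> R.
  under eq_bigr do rewrite cnt.
  rewrite exchange_big /=; apply: eq_bigr => g _.
  by rewrite natr_card; apply: eq_bigr => v _; rewrite inE.
have E2 : \sum_g #|[set K in F | K \subset U g]|%:R =
          \sum_(K in F) #|common K|%:R ^+ t :> R.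
  transitivity (\sum_(g : {ffun 'I_t -> W}) \sum_(K in F) [forall i, g i \in common K]%:R : R);
    last by rewrite exchange_big; apply: eq_bigr => K _; rewrite cnt.
  apply: eq_bigr => g _.
  rewrite natr_card [RHS]big_mkcond; apply: eq_bigr => K _.
  rewrite inE; case: (K \in F) => //=.
  suff -> : (K \subset U g) = [forall i, g i \in common K] by [].
  apply/subsetP/forallP => [h i|h v vK].
    by rewrite inE; apply/forall_inP => v /h; rewrite inE => /forallP.
  by rewrite inE; apply/forallP => i; have := h i; rewrite inE => /forall_inP; apply.
rewrite E1; apply: le_trans (ler_sum _ (fun g _ => card_le_hitting (U g) F0 big)) _.
rewrite big_split /= sumr_const card_ffun card_ord -natrX mulr_natr lerD2l E2.
rewrite mulr_natl -sumr_const; apply: ler_sum => K KF.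
by rewrite lerXn2r ?nnegrE ?small.
Qed.

(** If all common neighbourhoods had size at most [b * #|W|], then [dependent_random_choice] and
    [power_mean], divided by [#|W| ^ t], would contradict the gap. *)
Lemma drc_clique (e : rel V) r (m p b : R) t : (0 < r)%N -> (0 < #|W|)%N ->
  (forall U : {set V}, m <= #|U|%:R -> exists2 K, K \in cliques e r & K \subset U) ->
  0 <= p -> 0 <= b -> p * (#|V|%:R * #|W|%:R) <= \sum_v #|N v|%:R ->
  m + #|V|%:R ^+ r * b ^+ t < #|V|%:R * p ^+ t ->
  exists2 K, K \in cliques e r & b * #|W|%:R < #|common K|%:R.
Proof.
move=> r0 W0 big p0 b0 dens gap.
have [/exists_inP[K KF h]|] := boolP [exists K in cliques e r, b * #|W|%:R < #|common K|%:R].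
  by exists K.
rewrite negb_exists => /forallP small.
have F0 : set0 \notin cliques e r.
  by rewrite inE cards0 (ltn_eqF r0).
have bW : 0 <= b * #|W|%:R by rewrite mulr_ge0.
have := @dependent_random_choice _ m _ t F0 big bW _.
have sm : {in cliques e r, forall K, #|common K|%:R <= b * #|W|%:R}.
  by move=> K KF; have := small K; rewrite KF -leNgt.
move=> /(_ sm) up.
have pW : 0 <= p * #|W|%:R by rewrite mulr_ge0.
have dens' : #|V|%:R * (p * #|W|%:R) <= \sum_v #|N v|%:R.
  by rewrite mulrCA.
have lo := power_mean t (fun v => ler0n R #|N v|) pW dens'.
have Wt : 0 < #|W|%:R ^+ t :> R by rewrite exprn_gt0 // ltr0n.
have card : #|cliques e r|%:R <= #|V|%:R ^+ r :> R.
  by rewrite -natrX ler_nat card_cliques.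
have := ler_wpM2r (exprn_ge0 t bW) card.
have := le_trans lo up.
rewrite !exprMn; move: gap; rewrite -(ltr_pM2r Wt); lra.
Qed.

End DependentRandomChoice.

Lemma card_fibers (R : pzSemiRingType) (A B : finType) (S : {set A * B}) :
  #|S|%:R = \sum_a #|[set b | (a, b) \in S]|%:R :> R.
Proof.
rewrite natr_card; under [RHS]eq_bigr do rewrite natr_card.
rewrite pair_big /=; apply: eq_bigr => -[a b] _ /=.
by rewrite inE.
Qed.

(** * From many K4's to a K9 *)

Section ManyK4.
Variables (R : realFieldType) (V : finType) (e : rel V).
Hypotheses (eC : symmetric e) (eI : irreflexive e).

Definition K4 (x y z t : V) : bool :=
  [&& e x y, e x z, e x t, e y z, e y t & e z t].

Variables (s a kappa eps : R).
(* With n = s^800 all bounds in the proof are exact powers of s. *)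
Hypotheses (s0 : 0 < s) (s800 : #|V|%:R = (s ^+ 100) ^+ 8).
Hypothesis gap : a + (s ^+ 100) ^+ 6 < (s ^+ 100) ^+ 7.
Hypothesis edge_in : forall U : {set V}, a <= #|U|%:R ->
  exists2 K, K \in cliques e 2 & K \subset U.
Hypothesis triangle_in : forall U : {set V}, kappa * #|V|%:R <= #|U|%:R ->
  exists2 K, K \in cliques e 3 & K \subset U.
Hypothesis eps0 : 0 <= eps.
Hypothesis gap3 : kappa * #|V|%:R + 1 < #|V|%:R * eps ^+ (100 * 24).

(* Three rounds of dependent random choice, choosing a triangle, an edge and
   an edge in turn; the common neighbourhood left over at the end is still
   larger than the independence number and so contains a fourth clique. *)
Lemma many_K4_K9 :
  eps * #|V|%:R ^+ 4 <= \sum_x \sum_y \sum_z \sum_t (K4 x y z t)%:R ->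
  exists K, K \in cliques e 9.
Proof.
have := gap3; have := gap; have := s800.
set n := #|V|%:R : R; set u := s ^+ 100 => nE gap' gap3' many.
have u0 : 0 < u by rewrite exprn_gt0.
have n0 : 0 < n by rewrite nE exprn_gt0.
have V0 : (0 < #|V|)%N by rewrite -(ltr0n R).
have sV0 : 0 <= s^-1 by rewrite invr_ge0 ltW.
have sV : (s^-1) ^+ 100 = u^-1 by rewrite exprVn.
pose Q : {set V * (V * (V * V))} := [set w | K4 w.1 w.2.1 w.2.2.1 w.2.2.2].
have cQ : #|Q|%:R = \sum_x \sum_y \sum_z \sum_t (K4 x y z t)%:R :> R.
  rewrite card_fibers; apply: eq_bigr => x _.
  rewrite card_fibers; apply: eq_bigr => y _.
  rewrite card_fibers; apply: eq_bigr => z _.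
  by rewrite natr_card; apply: eq_bigr => t _; rewrite !inE.
(* Here [t = 2400], and [s^-1 ^+ 2400 = n ^- 3] reduces the clique term to [1], as in [gap3]. *)
have [K1 K1c Q1] : exists2 K, K \in cliques e 3 &
    s^-1 * #|{: V * (V * V)}|%:R < #|common (fun x => [set w | (x, w) \in Q]) K|%:R.
  apply: (@drc_clique _ _ _ _ e 3 (kappa * n) eps s^-1 (100 * 24)) => //.
  - by rewrite !card_prod !muln_gt0 V0.
  - rewrite -card_fibers cQ !card_prod !natrM -/n; apply: le_trans many.
    by rewrite !exprS expr0 mulr1.
  - have -> : n ^+ 3 * s^-1 ^+ (100 * 24) = 1.
      by rewrite exprM sV nE exprVn -exprM mulfV // expf_neq0 // gt_eqF.
    exact: gap3'.
set C1 := common _ _ in Q1.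
(* Density [s^-1], target [s^-1 ^+ 10], [t = 100]: the two sides of the gap become [a + u ^+ 6] and
   [u ^+ 7]. *)
have [K2 K2c Q2] : exists2 K, K \in cliques e 2 &
    s^-1 ^+ 10 * #|{: V * V}|%:R < #|common (fun y => [set w | (y, w) \in C1]) K|%:R.
  apply: (@drc_clique _ _ _ _ e 2 a s^-1 _ 100) => //.
  - by rewrite card_prod muln_gt0 V0.
  - by rewrite exprn_ge0.
  - by rewrite -card_fibers; apply: le_trans (ltW Q1); rewrite !card_prod !natrM.
  - rewrite -/n -exprM mulnC exprM sV nE.
    have -> : u ^+ 8 * u^-1 = u ^+ 7 by rewrite exprSr mulfK ?gt_eqF.
    apply: le_lt_trans gap'; rewrite lerD2l exprVn -exprM.
    rewrite (_ : 8 * 2 = 6 + 10)%N // exprD mulfK // expf_neq0 // gt_eqF //.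
set C2 := common _ _ in Q2.
(* Density [s^-1 ^+ 10], target [s^-1 ^+ 100 = u^-1], [t = 10]: the same two powers of [u]
   appear. *)
have [K3 K3c Q3] : exists2 K, K \in cliques e 2 &
    u^-1 * #|V|%:R < #|common (fun z => [set t | (z, t) \in C2]) K|%:R.
  apply: (@drc_clique _ _ _ _ e 2 a (s^-1 ^+ 10) _ 10) => //.
  - by rewrite exprn_ge0.
  - by rewrite invr_ge0 ltW.
  - by rewrite -card_fibers; apply: le_trans (ltW Q2); rewrite card_prod natrM.
  - rewrite -/n -exprM sV nE.
    have -> : u ^+ 8 * u^-1 = u ^+ 7 by rewrite exprSr mulfK ?gt_eqF.
    apply: le_lt_trans gap'; rewrite lerD2l exprVn -exprM.
    rewrite (_ : 8 * 2 = 6 + 10)%N // exprD mulfK // expf_neq0 // gt_eqF //.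
set C3 := common _ _ in Q3.
have [|L Lc LC] := @edge_in C3.
  apply: le_trans (ltW Q3); rewrite -/n nE exprSr mulrCA mulVf ?gt_eqF // mulr1.
  by apply: le_trans (ltW gap'); rewrite lerDl exprn_ge0 // ltW.
have all4 x y z t : x \in K1 -> y \in K2 -> z \in K3 -> t \in L ->
    K4 x y z t.
  move=> xK yK zK /(subsetP LC); rewrite inE => /forall_inP/(_ _ zK).
  rewrite !inE => /forall_inP/(_ _ yK); rewrite !inE => /forall_inP/(_ _ xK).
  by rewrite !inE.
have [x1 x1K] := cliques_nonempty (ltn0Sn _) K1c.
have [x2 x2K] := cliques_nonempty (ltn0Sn _) K2c.
have [x3 x3K] := cliques_nonempty (ltn0Sn _) K3c.
have [x4 x4K] := cliques_nonempty (ltn0Sn _)  Lc.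
exists (((K1 :|: K2) :|: K3) :|: L).
rewrite (_ : 9 = 3 + 2 + 2 + 2)%N //.
do 3?[apply: cliques_join => //].
- by move=> x y xK yK; have /and5P[] := all4 _ _ _ _ xK yK x3K x4K.
- move=> x z; rewrite inE => /orP[xK|yK] zK.
    by have /and5P[] := all4 _ _ _ _ xK x2K zK x4K.
  by have /and5P[_ _ _ ? _] := all4 _ _ _ _ x1K yK zK x4K.
- move=> x t; rewrite !inE => /orP[/orP[xK|yK]|zK] tK.
  + by have /and5P[] := all4 _ _ _ _ xK x2K x3K tK.
  + by have /and5P[_ _ _ _ /andP[? _]] := all4 _ _ _ _ x1K yK x3K tK.
  + by have /and5P[_ _ _ _ /andP[_ ?]] := all4 _ _ _ _ x1K x2K zK tK.
Qed.

End ManyK4.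

(** * Cliques between regular parts *)

Section RegularParts.
Variables (R : realFieldType) (V : finType) (e : rel V).
Implicit Types (A B X Y : {set V}).

Definition adjacency (x y : V) : R := (e x y)%:R.

Definition nbrs_in Y x : {set V} := [set y in Y | e x y].

Definition low_degree A Y (thr : R) : {set V} :=
  [set x in A | #|nbrs_in Y x|%:R < thr * #|Y|%:R].

Lemma nbrs_in_sub Y x : nbrs_in Y x \subset Y.
Proof. by apply/subsetP => y; rewrite inE => /andP[]. Qed.

Lemma adjacency01 x y : 0 <= adjacency x y <= 1.
Proof. by rewrite /adjacency; case: (e x y); rewrite ler01 lexx. Qed.

Lemma weight_adjacency X Y : weight adjacency X Y = \sum_(x in X) #|nbrs_in Y x|%:R.
Proof.
apply: eq_bigr => x _; rewrite natr_card big_mkcond; apply: eq_bigr => y _.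
by rewrite inE /adjacency; case: (y \in Y).
Qed.

(** A larger set of low-degree vertices would, together with [Y], violate regularity. Taking subsets
    [A'] and [Y] allows use inside neighbourhoods. *)
Lemma card_low_degree (eps d : R) A B A' Y : 0 <= eps ->
  lower_regular adjacency eps A B -> d <= density adjacency A B ->
  A' \subset A -> Y \subset B -> eps * #|B|%:R <= #|Y|%:R ->
  #|low_degree A' Y (d - eps)|%:R <= eps * #|A|%:R.
Proof.
move=> eps0 reg dAB A'A YB cY; rewrite leNgt; apply/negP => big.
set X := low_degree _ _ _ in big.
have XA : X \subset A.
  by apply: subset_trans A'A; apply/subsetP => x; rewrite inE => /andP[].
move/forallP/(_ X)/forallP/(_ Y)/implyP: reg.
rewrite XA YB (ltW big) cY => /(_ isT); rewrite weight_adjacency => wXY.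
have X0 : (0 < #|X|)%N.
  by rewrite -(ltr0n R); apply: le_lt_trans big; rewrite mulr_ge0.
have [x0 x0X] := card_gt0P X0.
have lt : \sum_(x in X) #|nbrs_in Y x|%:R < \sum_(x in X) ((d - eps) * #|Y|%:R).
  apply: ltr_sum; first by apply/hasP; exists x0; rewrite ?mem_index_enum.
  by move=> x; rewrite inE => /andP[].
move: (le_lt_trans wXY lt); rewrite sumr_const -[X in _ < X]mulr_natl ltNge => /negP; apply.
have -> : (density adjacency A B - eps) * (#|X|%:R * #|Y|%:R) =
  #|X|%:R * ((density adjacency A B - eps) * #|Y|%:R) by ring.
by rewrite ler_wpM2l // ler_wpM2r // lerB.
Qed.

Lemma cardsD_ge A B : #|A|%:R - #|B|%:R <= #|A :\: B|%:R :> R.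
Proof.
rewrite lerBlDr -natrD ler_nat -(cardsID B A) addnC leq_add2l.
by rewrite subset_leq_card // subsetIr.
Qed.

Lemma cardsU_le A B : #|A :|: B|%:R <= #|A|%:R + #|B|%:R :> R.
Proof. by rewrite -natrD ler_nat cardsU leq_subr. Qed.

Lemma nbrs_in_not_low A Y thr x : x \in A -> x \notin low_degree A Y thr ->
  thr * #|Y|%:R <= #|nbrs_in Y x|%:R.
Proof. by move=> xA; rewrite inE xA -leNgt. Qed.

Lemma sum_ge_card (S : {set V}) (F : V -> R) (l k : R) : (forall x, 0 <= F x) ->
  0 <= k -> l <= #|S|%:R -> {in S, forall x, k <= F x} -> l * k <= \sum_x F x.
Proof.
move=> F0 k0 lS kF; apply: le_trans (ler_wpM2r k0 lS) _.
rewrite mulr_natl -sumr_const big_mkcond; apply: ler_sum => x _.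
by case: ifP => // /kF.
Qed.

(** Vertices are chosen one by one, avoiding those of low degree into the current candidate sets, so
    each choice shrinks these by a factor [k] at most. The parts may coincide, which later excludes
    loops of the reduced graph. *)
Lemma count_K4 (eps d : R) A1 A2 A3 A4 : 0 <= eps -> 0 < d - eps -> d - eps <= 1 ->
  4 * eps <= (d - eps) ^+ 2 -> 6 * eps <= 1 ->
  let good A B := lower_regular adjacency eps A B && (d <= density adjacency A B) in
  good A1 A2 -> good A1 A3 -> good A1 A4 -> good A2 A3 -> good A2 A4 -> good A3 A4 ->
  (#|A1|%:R / 2) * (((d - eps) ^+ 2 / 2 * #|A2|%:R) *
     (((d - eps) ^+ 2 / 2 * #|A3|%:R) * ((d - eps) ^+ 3 * #|A4|%:R))) <=
  \sum_x \sum_y \sum_z \sum_t (K4 e x y z t)%:R.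
Proof.
set k := d - eps => eps0 k0 k1 k2 e6 good.
move=> /andP[r12 d12] /andP[r13 d13] /andP[r14 d14] /andP[r23 d23] /andP[r24 d24] /andP[r34 d34].
have k2k : k ^+ 2 <= k by rewrite expr2 ler_piMl // ltW.
have kk : 0 <= k ^+ 2 by rewrite sqr_ge0.
have k3 : 0 <= k ^+ 3 by rewrite exprn_ge0 // ltW.
have c0 (A : {set V}) : 0 <= #|A|%:R :> R by [].
have epsk (j : R) A : 4 * eps <= j -> eps * #|A|%:R <= j * #|A|%:R.
  by move=> h; apply: ler_wpM2r => //; lra.
have nn : forall x y z, 0 <= \sum_t (K4 e x y z t)%:R :> R.
  by move=> x y z; apply: sumr_ge0.
have eA (A : {set V}) : eps * #|A|%:R <= #|A|%:R.
  by rewrite -[leRHS]mul1r; apply: ler_wpM2r => //; lra.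
pose G1 := A1 :\: (low_degree A1 A2 k :|: low_degree A1 A3 k :|: low_degree A1 A4 k).
apply: (@sum_ge_card G1).
- by move=> x; do 2![apply: sumr_ge0 => ? _]; exact: nn.
- by do !apply: mulr_ge0 => //; rewrite invr_ge0.
- apply: le_trans (cardsD_ge _ _).
  have := card_low_degree eps0 r12 d12 (subxx _) (subxx _) (eA _).
  have := card_low_degree eps0 r13 d13 (subxx _) (subxx _) (eA _).
  have := card_low_degree eps0 r14 d14 (subxx _) (subxx _) (eA _).
  have := cardsU_le (low_degree A1 A2 k :|: low_degree A1 A3 k) (low_degree A1 A4 k).
  have := cardsU_le (low_degree A1 A2 k) (low_degree A1 A3 k).
  have := ler_wpM2r (c0 A1) e6; rewrite -/k; lra.
move=> x; rewrite 3!inE !negb_or -!andbA => /and4P[nx2 nx3 nx4 xA].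
have B2 := nbrs_in_not_low xA nx2; have B3 := nbrs_in_not_low xA nx3.
have B4 := nbrs_in_not_low xA nx4.
pose G2 := nbrs_in A2 x :\:
  (low_degree (nbrs_in A2 x) (nbrs_in A3 x) k :|:
   low_degree (nbrs_in A2 x) (nbrs_in A4 x) k).
have ek : 4 * eps <= k by lra.
apply: (@sum_ge_card G2).
- by move=> y; apply: sumr_ge0 => ? _; exact: nn.
- by do !apply: mulr_ge0 => //; rewrite invr_ge0.
- apply: le_trans (cardsD_ge _ _).
  have := card_low_degree eps0 r23 d23 (nbrs_in_sub A2 x) (nbrs_in_sub A3 x)
            (le_trans (epsk _ _ ek) B3).
  have := card_low_degree eps0 r24 d24 (nbrs_in_sub A2 x) (nbrs_in_sub A4 x)
            (le_trans (epsk _ _ ek) B4).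
  have := cardsU_le (low_degree (nbrs_in A2 x) (nbrs_in A3 x) k)
            (low_degree (nbrs_in A2 x) (nbrs_in A4 x) k).
  have := ler_wpM2r (c0 A2) k2; have := ler_wpM2r (c0 A2) k2k; rewrite -/k; lra.
move=> y; rewrite 2!inE !negb_or -!andbA => /and3P[ny3 ny4 yB].
have C3 := nbrs_in_not_low yB ny3; have C4 := nbrs_in_not_low yB ny4.
set X3 := nbrs_in (nbrs_in A3 x) y in C3; set X4 := nbrs_in (nbrs_in A4 x) y in C4.
have X3A : X3 \subset A3 by apply: subset_trans (nbrs_in_sub _ _) (nbrs_in_sub _ _).
have X4A : X4 \subset A4 by apply: subset_trans (nbrs_in_sub _ _) (nbrs_in_sub _ _).
have C3' : k ^+ 2 * #|A3|%:R <= #|X3|%:R.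
  by apply: le_trans C3; rewrite expr2 -mulrA ler_wpM2l // ltW.
have C4' : k ^+ 2 * #|A4|%:R <= #|X4|%:R.
  by apply: le_trans C4; rewrite expr2 -mulrA ler_wpM2l // ltW.
pose G3 := X3 :\: low_degree X3 X4 k.
apply: (@sum_ge_card G3).
- by move=> z; exact: nn.
- by rewrite mulr_ge0.
- apply: le_trans (cardsD_ge _ _).
  have := card_low_degree eps0 r34 d34 X3A X4A (le_trans (epsk _ _ k2) C4').
  have := ler_wpM2r (c0 A3) k2; have := mulr_ge0 kk (c0 A3); rewrite -/k; lra.
move=> z; rewrite inE => /andP[nz4 zX].
have D4 := nbrs_in_not_low zX nz4.
apply: (@le_trans _ _ #|nbrs_in X4 z|%:R).
  by apply: le_trans D4; rewrite exprS -mulrA ler_wpM2l // ltW.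
rewrite natr_card; apply: ler_sum => t _; rewrite ler_nat.
move: yB zX; rewrite !inE /K4 => /andP[_ ->] /andP[/andP[_ ->] ->].
by case: (t \in A4); case: (e x t); case: (e y t); case: (e z t).
Qed.

(** Union bound: each of the three vertices misses at most a fraction [1 - thr] of [Y]. *)
Lemma card_common_nbrs (K Y : {set V}) (thr : R) : #|K| = 3 ->
  {in K, forall v, thr * #|Y|%:R <= #|nbrs_in Y v|%:R} ->
  (3 * thr - 2) * #|Y|%:R <= #|[set y in Y | [forall v in K, e v y]]|%:R.
Proof.
move=> cK h; set Z := [set y in Y | _].
have E : \sum_(v in K) (#|Y|%:R - #|nbrs_in Y v|%:R) =
    \sum_(y in Y) \sum_(v in K) (~~ e v y)%:R :> R.
  rewrite exchange_big; apply: eq_bigr => v _; rewrite [in RHS]big_mkcond !natr_card -sumrB.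
  apply: eq_bigr => y _; rewrite inE; case: (y \in Y); case: (e v y) => /=; lra.
have : #|Y|%:R - #|Z|%:R <= \sum_(y in Y) \sum_(v in K) (~~ e v y)%:R :> R.
  rewrite [leRHS]big_mkcond !natr_card -sumrB; apply: ler_sum => y _.
  rewrite inE; case: (y \in Y) => /=; last by rewrite subrr.
  case: (boolP [forall v in K, e v y]) => [_|]; first by rewrite subrr sumr_ge0.
  rewrite negb_forall => /existsP[v]; rewrite negb_imply => /andP[vK nev].
  by rewrite (bigD1 v) //= nev subr0 lerDl sumr_ge0.
rewrite -E.
have : \sum_(v in K) (#|Y|%:R - #|nbrs_in Y v|%:R) <= \sum_(v in K) ((1 - thr) * #|Y|%:R).
  by apply: ler_sum => v /h; lra.
rewrite sumr_const cK -[X in _ <= X -> _]mulr_natl; lra.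
Qed.

Hypotheses (eC : symmetric e) (eI : irreflexive e).

(** Take a triangle among typical vertices of [A1], a second one in its common neighbourhood in
    [A2], and a third in the common neighbourhood of both in [A3]. Each triangle keeps at least a
    fraction [eta] of the later sets. *)
Lemma dense_triangle_K9 (kappa eps eta : R) A1 A2 A3 : 0 <= eps -> 2 * eps <= eta ->
  6 * eta <= 1 ->
  let good A B := lower_regular adjacency eps A B &&
    (2 / 3 + eta <= density adjacency A B) in
  good A1 A2 -> good A1 A3 -> good A2 A3 ->
  (forall U : {set V}, kappa <= #|U|%:R ->
     exists2 K, K \in cliques e 3 & K \subset U) ->
  kappa <= #|A1|%:R / 2 -> kappa <= eta / 2 * #|A2|%:R -> kappa <= eta ^+ 2 * #|A3|%:R ->
  exists K, K \in cliques e 9.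
Proof.
set d := 2 / 3 + eta => eps0 epsn n6 good /andP[r12 d12] /andP[r13 d13] /andP[r23 d23].
move=> big h1 h2 h3.
have c0 (A : {set V}) : 0 <= #|A|%:R :> R by [].
have eta0 : 0 <= eta by lra.
have eA (A : {set V}) : eps * #|A|%:R <= #|A|%:R.
  by rewrite -[leRHS]mul1r; apply: ler_wpM2r => //; lra.
have eE (A : {set V}) : eps * #|A|%:R <= eta * #|A|%:R.
  by apply: ler_wpM2r => //; lra.
(* The factor on the right is [3 * eta - 3 * eps], and [eps] is at most [eta / 2]. *)
have thr (A : {set V}) : eta * #|A|%:R <= (3 * (d - eps) - 2) * #|A|%:R.
  by apply: ler_wpM2r => //; rewrite /d; lra.
pose N (K Y : {set V}) := [set y in Y | [forall v in K, e v y]].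
have NP (K Y : {set V}) y : y \in N K Y -> {in K, forall v, e v y}.
  by rewrite inE => /andP[_ /forall_inP].
have [|T1 T1c /subsetP T1A] :=
  big (A1 :\: (low_degree A1 A2 (d - eps) :|: low_degree A1 A3 (d - eps))).
  apply: le_trans h1 _; apply: le_trans (cardsD_ge _ _).
  have := card_low_degree eps0 r12 d12 (subxx _) (subxx _) (eA _).
  have := card_low_degree eps0 r13 d13 (subxx _) (subxx _) (eA _).
  have := cardsU_le (low_degree A1 A2 (d - eps)) (low_degree A1 A3 (d - eps)).
  have e4 : 4 * eps <= 1 by lra.
  have := ler_wpM2r (c0 A1) e4; lra.
have [cT1 _] := cliquesP _ _ _ T1c.
have B2 : eta * #|A2|%:R <= #|N T1 A2|%:R.
  apply: le_trans (thr _) _; apply: card_common_nbrs => // v /T1A.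
  by rewrite 2!inE negb_or => /andP[/andP[nl _] vA]; apply: nbrs_in_not_low nl.
have B3 : eta * #|A3|%:R <= #|N T1 A3|%:R.
  apply: le_trans (thr _) _; apply: card_common_nbrs => // v /T1A.
  by rewrite 2!inE negb_or => /andP[/andP[_ nl] vA]; apply: nbrs_in_not_low nl.
have NS (K Y : {set V}) : N K Y \subset Y by apply/subsetP => y; rewrite inE => /andP[].
have [|T2 T2c /subsetP T2A] := big (N T1 A2 :\: low_degree (N T1 A2) (N T1 A3) (d - eps)).
  apply: le_trans h2 _; apply: le_trans (cardsD_ge _ _).
  have := card_low_degree eps0 r23 d23 (NS T1 A2) (NS T1 A3) (le_trans (eE _) B3).
  have := ler_wpM2r (c0 A2) epsn; lra.
have [cT2 _] := cliquesP _ _ _ T2c.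
have C3 : eta * #|N T1 A3|%:R <= #|N T2 (N T1 A3)|%:R.
  apply: le_trans (thr _) _; apply: card_common_nbrs => // v /T2A.
  by rewrite inE => /andP[nl vA]; apply: nbrs_in_not_low nl.
have [|T3 T3c /subsetP T3A] := big (N T2 (N T1 A3)).
  apply: le_trans h3 _; apply: le_trans C3.
  by rewrite expr2 -mulrA ler_wpM2l.
exists ((T1 :|: T2) :|: T3).
rewrite (_ : 9 = 3 + 3 + 3)%N //; do 2?[apply: cliques_join => //].
- by move=> x y xT /T2A; rewrite inE => /andP[_ /NP]; apply.
- move=> x z; rewrite inE => /orP[xT|xT] /T3A zN.
    by move: (subsetP (NS _ _) _ zN) => /NP; apply.
  exact: NP zN _ xT.
Qed.

End RegularParts.

(** * The reduced graph of a regular partition *)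

Section ReducedGraph.
Variables (R : realFieldType) (V : finType) (e : rel V).
Hypothesis eC : symmetric e.
Variables (C : finType) (c : V -> C) (eps d mu : R).
Let n : R := #|V|%:R.
Let f : V -> V -> R := adjacency R e.

(** Regularity is asked for in both orders so that the relation is visibly symmetric; [a = b] is
    allowed. *)
Definition reduced_edge (a b : C) : bool :=
  [&& mu * n <= #|part c a|%:R, mu * n <= #|part c b|%:R,
      lower_regular f eps (part c a) (part c b), lower_regular f eps (part c b) (part c a)
    & d <= density f (part c a) (part c b)].

Definition reduced_weight (a b : C) : R :=
  if reduced_edge a b then density f (part c a) (part c b) else 0.

Lemma density_sym A B : density f A B = density f B A.
Proof.
rewrite /density; congr (_ / _).
  rewrite /weight exchange_big; apply: eq_bigr => y _.
  by apply: eq_bigr => x _; rewrite /f /adjacency eC.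
by rewrite mulrC.
Qed.

Lemma reduced_edgeC a b : reduced_edge a b = reduced_edge b a.
Proof.
by rewrite /reduced_edge density_sym; apply/and5P/and5P => -[-> -> -> -> ->].
Qed.

Lemma reduced_weightC a b : reduced_weight a b = reduced_weight b a.
Proof. by rewrite /reduced_weight reduced_edgeC density_sym. Qed.

Lemma reduced_weight01 a b : 0 <= reduced_weight a b <= 1.
Proof.
rewrite /reduced_weight; case: ifP => _; last by rewrite lexx ler01.
by rewrite density_ge0 ?density_le1 //; apply: adjacency01.
Qed.

Lemma reduced_weight_gt0 a b : 0 < reduced_weight a b -> reduced_edge a b.
Proof. by rewrite /reduced_weight; case: ifP => //; rewrite ltxx. Qed.

(** One error term for each reason why a pair is no reduced edge: low density costs at most [d], any
    other reason at most [1]. *)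
Lemma weight_le_reduced a b : 0 <= d ->
  weight f (part c a) (part c b) <=
  reduced_weight a b * #|part c a|%:R * #|part c b|%:R +
  ((~~ lower_regular f eps (part c a) (part c b))%:R +
   (~~ lower_regular f eps (part c b) (part c a))%:R + d +
   (#|part c a|%:R < mu * n)%R%:R + (#|part c b|%:R < mu * n)%R%:R) *
    (#|part c a|%:R * #|part c b|%:R).
Proof.
move=> d0; have f01 := adjacency01 R e.
rewrite -(weightE f01) -mulrA -mulrDl ler_wpM2r ?mulr_ge0 //.
have := density_le1 f01 (part c a) (part c b).
have := density_ge0 f01 (part c a) (part c b).
rewrite /reduced_weight /reduced_edge -/f; set D := density _ _ _ => D0 D1.
case: (leP (mu * n) #|part c a|%:R) => _; last first.
  by do 2!case: (lower_regular _ _ _ _); case: (#|part c b|%:R < _) => /=; lra.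
case: (leP (mu * n) #|part c b|%:R) => _; last by do 2!case: (lower_regular _ _ _ _) => /=; lra.
do 2?[case: (lower_regular _ _ _ _) => /=]; try lra.
by case: (leP d D) => h /=; lra.
Qed.

(** The factors [2] come from the two orders of regularity and from the two sides that may be small;
    the small parts together hold at most [#|C| * mu * n] vertices. *)
Lemma reduced_sum : 0 <= d -> 0 <= mu ->
  \sum_x \sum_y f x y <= quad reduced_weight (fun a => #|part c a|%:R) +
    2 * irregular f eps c + d * n ^+ 2 + 2 * (#|C|%:R * mu) * n ^+ 2.
Proof.
move=> d0 mu0; rewrite (sum_part c).
pose X a : R := #|part c a|%:R.
have SX : \sum_a X a = n by apply: sum_card_part.
have small : \sum_a (X a < mu * n)%R%:R * X a <= #|C|%:R * mu * n.
  rewrite -mulrA mulr_natl -sumr_const; apply: ler_sum => a _.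
  by case: ltP => [/ltW|_]; rewrite ?mul1r ?mul0r // mulr_ge0 // mulr_ge0.
have E1 : \sum_a \sum_b (~~ lower_regular f eps (part c a) (part c b))%:R * (X a * X b) =
    irregular f eps c.
  apply: eq_bigr => a _; rewrite [RHS]big_mkcond; apply: eq_bigr => b _.
  by case: ifP => _; rewrite ?mul1r ?mul0r.
have E2 : \sum_a \sum_b (~~ lower_regular f eps (part c b) (part c a))%:R * (X a * X b) =
    irregular f eps c.
  rewrite -E1 exchange_big; apply: eq_bigr => a _; apply: eq_bigr => b _.
  by rewrite [X b * _]mulrC.
have E3 : \sum_a \sum_b d * (X a * X b) = d * n ^+ 2.
  under eq_bigr do rewrite -mulr_sumr -mulr_sumr SX.
  by rewrite -mulr_sumr -mulr_suml SX.
have E4 : \sum_a \sum_b (X a < mu * n)%R%:R * (X a * X b) <= #|C|%:R * mu * n ^+ 2.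
  under eq_bigr do (under eq_bigr do rewrite mulrA; rewrite -mulr_sumr SX).
  by rewrite -mulr_suml expr2 mulrA ler_wpM2r.
have E5 : \sum_a \sum_b (X b < mu * n)%R%:R * (X a * X b) <= #|C|%:R * mu * n ^+ 2.
  apply: le_trans E4; rewrite exchange_big le_eqVlt; apply/orP; left; apply/eqP.
  by apply: eq_bigr => a _; apply: eq_bigr => b _; rewrite [X b * _]mulrC.
apply: (@le_trans _ _ (\sum_a \sum_b (reduced_weight a b * X a * X b +
  ((~~ lower_regular f eps (part c a) (part c b))%:R * (X a * X b) +
   (~~ lower_regular f eps (part c b) (part c a))%:R * (X a * X b) + d * (X a * X b) +
   (X a < mu * n)%R%:R * (X a * X b) + (X b < mu * n)%R%:R * (X a * X b))))).
  apply: ler_sum => a _; apply: ler_sum => b _; rewrite -!mulrDl.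
  exact: weight_le_reduced.
under eq_bigr do rewrite !big_split /=.
rewrite !big_split /= E1 E2 E3 /quad; lra.
Qed.

End ReducedGraph.

(* Every edge is counted twice, hence 3/5 in place of 3/10. *)
Lemma K9_free_edge_density (R : archiRealFieldType) (gamma : R) : 0 < gamma ->
  exists kappa n0 : R, 0 < kappa /\
  forall (V : finType) (e : rel V) (s a : R), symmetric e -> irreflexive e ->
    0 < s -> #|V|%:R = (s ^+ 100) ^+ 8 -> n0 < #|V|%:R ->
    a + (s ^+ 100) ^+ 6 < (s ^+ 100) ^+ 7 ->
    (forall U : {set V}, a <= #|U|%:R ->
       exists2 K, K \in cliques e 2 & K \subset U) ->
    (forall U : {set V}, kappa * #|V|%:R <= #|U|%:R ->
       exists2 K, K \in cliques e 3 & K \subset U) ->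
    (forall K, K \notin cliques e 9) ->
    \sum_x \sum_y (e x y)%:R <= (3 / 5 + 2 * gamma) * #|V|%:R ^+ 2.
Proof.
move=> gamma0; pose g := Num.min gamma 1.
have g0 : 0 < g by rewrite lt_min gamma0 ltr01.
have g1 : g <= 1 by rewrite ge_min lexx orbT.
have gg : g <= gamma by rewrite ge_min lexx.
have g2 : 0 < g ^+ 2 by rewrite exprn_gt0.
have g2g : g ^+ 2 <= g by rewrite expr2 ler_piMl // ltW.
(* The errors stay below [2 * g]: [2 * eta] and [d] are [g / 4] each, irregular pairs cost
   [2 * eps <= g / 256], and small parts at most [g] by the choice of [mu]. *)
pose eta := g / 8; pose d := g / 4; pose eps := g ^+ 2 / 512.
have eps0 : 0 < eps by rewrite divr_gt0.
have [K HK] := regularity eps0.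
pose mu := g / (2 * K.+1%:R).
have mu0 : 0 < mu by rewrite divr_gt0 // mulr_gt0.
have Kmu : 2 * (K%:R * mu) <= g.
  have E : 2 * K.+1%:R * mu = g by rewrite mulrC divfK // mulf_neq0 // pnatr_eq0.
  by move: E; rewrite -natr1; have := mu0; lra.
pose k := d - eps.
have kg : g / 5 <= k by rewrite /k /d /eps; lra.
have k0 : 0 < k by lra.
have k1 : k <= 1 by rewrite /k /d; lra.
have k2 : 4 * eps <= k ^+ 2.
  have : (g / 5) ^+ 2 <= k ^+ 2 by rewrite lerXn2r ?nnegrE //; lra.
  by rewrite /eps expr_div_n; lra.
(* The proportion of K4's that [count_K4] yields for four parts of size [mu * n]. *)
pose e4 := (mu / 2) * ((k ^+ 2 / 2 * mu) * ((k ^+ 2 / 2 * mu) * (k ^+ 3 * mu))).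
have e40 : 0 < e4.
  have two : 0 < 2 :> R by [].
  have kk := divr_gt0 (exprn_gt0 2 k0) two; have kmu := mulr_gt0 kk mu0.
  have kkk := mulr_gt0 (exprn_gt0 3 k0) mu0.
  exact: (mulr_gt0 (divr_gt0 mu0 two) (mulr_gt0 kmu (mulr_gt0 kmu kkk))).
pose h := e4 ^+ (100 * 24).
have h0 : 0 < h by rewrite exprn_gt0.
have eta0 : 0 < eta by rewrite divr_gt0.
have eta1 : eta <= 1 by rewrite /eta; lra.
have eta2 : 0 < eta ^+ 2 by rewrite exprn_gt0.
have eta21 : eta ^+ 2 <= eta by rewrite expr2 ler_piMl // ltW.
(* The first term gives [gap3] once [n > 2 / h]; the second meets the three size conditions of
   [dense_triangle_K9]. *)
pose kappa := Num.min (h / 2) (mu * eta ^+ 2 / 2).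
exists kappa, (2 / h); split.
  by rewrite lt_min (divr_gt0 h0) // divr_gt0 // mulr_gt0.
move=> V e s a eC eI s0 nE n0 gap edge_in triangle_in noK9.
set n := #|V|%:R in nE n0 *.
have np : 0 < n by apply: lt_trans n0; rewrite divr_gt0.
have gap3 : kappa * n + 1 < n * h.
  have : kappa * n <= h / 2 * n by rewrite ler_pM2r // ge_min lexx.
  by move: n0; rewrite ltr_pdivrMr //; lra.
have [C [c [cardC irr]]] := HK V _ (adjacency01 R e).
have noQ : ~~ (e4 * n ^+ 4 <= \sum_x \sum_y \sum_z \sum_t (K4 e x y z t)%:R).
  apply/negP => /(many_K4_K9 eC eI s0 nE gap edge_in triangle_in (ltW e40) gap3).
  by case=> L; apply/negP.
pose E := reduced_edge e c eps d mu.
have EP x y : E x y -> mu * n <= #|part c x|%:R /\ mu * n <= #|part c y|%:R /\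
    lower_regular (adjacency R e) eps (part c x) (part c y) &&
    (d <= density (adjacency R e) (part c x) (part c y)).
  by case/and5P => -> -> -> _ ->.
have noK4 x y z t : ~~ [&& E x y, E x z, E x t, E y z, E y t & E z t].
  apply/negP => /and5P[/EP[bx [by_ xy]] /EP[_ [bz xz]] /EP[_ [bt xt]] /EP[_ [_ yz]]].
  move=> /andP[/EP[_ [_ yt]] /EP[_ [_ zt]]].
  move/negP: noQ; apply.
  apply: le_trans (count_K4 (ltW eps0) k0 k1 k2 _ xy xz xt yz yt zt); last first.
    by rewrite /eps; lra.
  rewrite -/k.
  have -> : e4 * n ^+ 4 = (mu * n / 2) * ((k ^+ 2 / 2 * (mu * n)) *
      ((k ^+ 2 / 2 * (mu * n)) * (k ^+ 3 * (mu * n)))) by rewrite /e4; ring.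
  have mn : 0 <= mu * n by rewrite mulr_ge0 // ltW.
  have kk : 0 <= k ^+ 2 / 2 by rewrite divr_ge0 // sqr_ge0.
  have kkk : 0 <= k ^+ 3 by rewrite exprn_ge0 // ltW.
  have kmn := mulr_ge0 kk mn; have kkkmn := mulr_ge0 kkk mn.
  have kmn2 := mulr_ge0 kmn kkkmn; have kmn3 := mulr_ge0 kmn kmn2.
  apply: ler_pM => //; first by rewrite divr_ge0.
    by rewrite ler_pM2r // invr_gt0.
  apply: ler_pM => //; first exact: ler_wpM2l.
  by apply: ler_pM => //; apply: ler_wpM2l.
pose w := reduced_weight e c eps d mu.
have wE x y : 0 < w x y -> E x y by apply: reduced_weight_gt0.
(* A loop would be a reduced K4 with four equal vertices. *)
have waa x : w x x = 0.
  by rewrite /w /reduced_weight; case: ifP => // xx; have := noK4 x x x x; rewrite /E xx.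
have tri x y z : 0 < w x y -> 0 < w x z -> 0 < w y z ->
    [|| w x y <= 2 / 3 + eta, w x z <= 2 / 3 + eta | w y z <= 2 / 3 + eta].
  move=> /wE xy /wE xz /wE yz; rewrite /w /reduced_weight -/E xy xz yz !leNgt -!negb_and.
  apply/negP => /and3P[/ltW dxy /ltW dxz /ltW dyz].
  have [bx [by_ /andP[rxy _]]] := EP _ _ xy.
  have [_ [bz /andP[rxz _]]] := EP _ _ xz; have [_ [_ /andP[ryz _]]] := EP _ _ yz.
  have kn : kappa * n <= mu * n * (eta ^+ 2 / 2).
    have : kappa * n <= mu * eta ^+ 2 / 2 * n by rewrite ler_pM2r // ge_min lexx orbT.
    by lra.
  have mn : 0 < mu * n by rewrite mulr_gt0.
  have [||||||||L Lc] :=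
    @dense_triangle_K9 R V e eC eI (kappa * n) eps eta (part c x) (part c y) (part c z)
      (ltW eps0) _ _ _ _ _ triangle_in.
  - by rewrite /eta /eps; lra.
  - by rewrite /eta; lra.
  - by rewrite rxy dxy.
  - by rewrite rxz dxz.
  - by rewrite ryz dyz.
  - apply: le_trans kn _; have := ler_wpM2l (ltW mn) (le_trans eta21 eta1); lra.
  - apply: le_trans kn _; rewrite mulrC.
    have : eta / 2 * (mu * n) <= eta / 2 * #|part c y|%:R by rewrite ler_pM2l // divr_gt0.
    by have := ler_wpM2l (ltW mn) eta21; lra.
  - apply: le_trans kn _.
    have : eta ^+ 2 * (mu * n) <= eta ^+ 2 * #|part c z|%:R by rewrite ler_pM2l.
    by have := mulr_ge0 (ltW eta2) (ltW mn); lra.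
  - by have := noK9 L; rewrite Lc.
have turan := @weighted_turan R C w eta (ltW eta0) (reduced_weightC eC c eps d mu) waa
  (reduced_weight01 e c eps d mu) _ tri (fun x => #|part c x|%:R) (fun x => ler0n _ _).
have noK4' x y z t : ~~ [&& 0 < w x y, 0 < w x z, 0 < w x t, 0 < w y z, 0 < w y t & 0 < w z t].
  apply: contraNN (noK4 x y z t) => /and5P[/wE-> /wE-> /wE-> /wE->].
  by case/andP => /wE-> /wE->.
move: (turan noK4'); rewrite (sum_card_part R c) -/n => tur.
have d0 : 0 <= d by rewrite divr_ge0 // ltW.
rewrite -[leLHS]/(\sum_x \sum_y adjacency R e x y).
apply: le_trans (reduced_sum e c eps d0 (ltW mu0)) _; rewrite -/n -/w.
have n2 : 0 < n ^+ 2 by rewrite exprn_gt0.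
have Cmu : 2 * (#|C|%:R * mu) * n ^+ 2 <= g * n ^+ 2.
  rewrite ler_pM2r //; apply: le_trans Kmu.
  by rewrite ler_pM2l // ler_pM2r // ler_nat.
have en : 2 * (eps * n ^+ 2) <= g / 256 * n ^+ 2.
  by rewrite mulrA ler_pM2r // /eps; lra.
have gn : g * n ^+ 2 <= gamma * n ^+ 2 by rewrite ler_pM2r.
have gn0 := mulr_gt0 g0 n2.
by move: irr tur; rewrite -/n /eta /d; lra.
Qed.

(** * Inverse Ramsey numbers *)

Local Open Scope nat_scope.

Lemma adjC (T : finType) (G : sgraph T) : symmetric (adj G).
Proof. by move=> x y; rewrite /adj setUC. Qed.

Lemma adj_irr (T : finType) (G : sgraph T) : irreflexive (adj G).
Proof.
move=> x; rewrite /adj; apply/negP => xG.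
have /forall_inP/(_ _ xG) := edges_card2 G.
by rewrite setUid cards1.
Qed.

Lemma independentP (T : finType) (G : sgraph T) (S : {set T}) :
  reflect {in S &, forall x y, ~~ adj G x y} (independent G S).
Proof.
apply: (iffP forall_inP) => [h x y xS yS|h x xS]; last by apply/forall_inP => y; exact: h.
by have /forall_inP := h x xS; apply.
Qed.

Lemma leq_alpha (T : finType) (G : sgraph T) (S : {set T}) :
  independent G S -> #|S| <= alpha G.
Proof. exact: leq_bigmax_cond. Qed.

Lemma adj_complete r (x y : 'I_r) : adj (complete_graph r) x y = (x != y).
Proof. by rewrite /adj inE cards2 eqSS; case: (x != y). Qed.

Lemma cliques_contains (T : finType) (G : sgraph T) r K : K \in cliques (adj G) r ->
  contains (complete_graph r) G.
Proof.
move=> /cliquesP[cK hK].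
have lt (i : 'I_r) : i < #|K| by rewrite cK.
pose h := [ffun i : 'I_r => enum_val (Ordinal (lt i))].
have hinj : injective h.
  by move=> i j; rewrite !ffunE => /enum_val_inj/(congr1 val) => ij; apply: val_inj.
apply/existsP; exists h; apply/andP; split; first by apply/injectiveP.
apply/forallP => i; apply/forallP => j; apply/implyP; rewrite adj_complete => ij.
by apply: hK; rewrite ?(inj_eq hinj) // !ffunE enum_valP.
Qed.

Lemma inverse_ramsey_le r n (G : sgraph 'I_n) : graph_free (complete_graph r) G ->
  inverse_ramsey r n <= alpha G.
Proof.
move=> GF; rewrite /inverse_ramsey.
have : G \in index_enum (sgraph 'I_n) by rewrite mem_index_enum.
elim: (index_enum _) => // H l IH; rewrite inE big_cons => /orP[/eqP <-|/IH le].
  by rewrite GF geq_minl.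
by case: ifP => // _; rewrite geq_min le orbT.
Qed.

(** Upper bounds on the inverse Ramsey number can thus be built on any finite type: keep [n]
    vertices of [D] and number them. *)
Lemma inverse_ramsey3_le (T : finType) (e : rel T) (D : {set T}) n a :
  symmetric e -> n <= #|D| ->
  {in D & &, forall x y z, ~~ [&& e x y, e x z & e y z]} ->
  (forall S : {set T}, S \subset D -> {in S &, forall x y, x != y -> ~~ e x y} -> #|S| <= a) ->
  inverse_ramsey 3 n <= a.
Proof.
move=> eC nD tfree ind.
pose f (i : 'I_n) := enum_val (widen_ord nD i).
have finj : injective f by move=> i j /enum_val_inj/(congr1 val) => ij; apply: val_inj.
have fD i : f i \in D by rewrite enum_valP.
pose E : {set {set 'I_n}} := [set [set p.1; p.2] |
  p in [pred p : 'I_n * 'I_n | (p.1 != p.2) && e (f p.1) (f p.2)]].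
have E2 : [forall s in E, #|s| == 2%N].
  by apply/forall_inP => s /imsetP[[i j] /= /andP[/= ij _] ->]; rewrite cards2 ij.
pose G := SGraph E2.
have adjG i j : adj G i j = (i != j) && e (f i) (f j).
  apply/imsetP/idP => [[[i' j'] /= /andP[/= nij eij] E']|h]; last by exists (i, j).
  have ii : i \in [set i'; j'] by rewrite -E' !inE eqxx.
  have jj : j \in [set i'; j'] by rewrite -E' !inE eqxx orbT.
  have i'i : i' \in [set i; j] by rewrite E' !inE eqxx.
  have j'j : j' \in [set i; j] by rewrite E' !inE eqxx orbT.
  move: ii jj i'i j'j; rewrite !inE => /orP[/eqP->|/eqP->] /orP[/eqP->|/eqP->].
  - by rewrite !orbb [j' == _]eq_sym (negPf nij).
  - by rewrite nij eij.
  - by move=> _ _; rewrite eq_sym nij eC.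
  - by rewrite !orbb (negPf nij).
apply: (@leq_trans (alpha G)).
  apply: inverse_ramsey_le; apply/negP => /existsP[h /andP[/injectiveP hi /forallP hh]].
  have A i j : i != j -> e (f (h i)) (f (h j)).
    move=> ij; have /forallP/(_ j)/implyP := hh i.
    by rewrite adj_complete adjG => /(_ ij) /andP[].
  have := tfree _ _ _ (fD (h (@Ordinal 3 0 isT))) (fD (h (@Ordinal 3 1 isT)))
                      (fD (h (@Ordinal 3 2 isT))).
  by rewrite !A.
rewrite /alpha; apply/bigmax_leqP => S /independentP iS.
rewrite -(card_imset S finj); apply: ind.
  by apply/subsetP => _ /imsetP[i _ ->].
move=> _ _ /imsetP[i iS' ->] /imsetP[j jS ->] nij.
have := iS i j iS' jS; rewrite adjG.
by have -> : i != j by apply: contraNneq nij => ->.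
Qed.

(* Vertices are the flags (a, b, x): a line y = a x + b together with the point
   of abscissa x on it.  Flag (a, b, x) points to (a', b', x') if x < x', the
   lines differ and the second point lies on the first line; three pairwise
   joined flags would give two distinct lines through two points.  In an
   independent set every flag is either the first one on its line or the only
   one at its point. *)
Lemma inverse_ramsey3_flags n m : n <= m ^ 4 -> inverse_ramsey 3 n <= 3 * m ^ 3.
Proof.
move=> nm.
(* There are [m ^ 3] lines with [m] flags each; ordinates stay below [2 * m ^ 2], which leaves room
   for at most [2 * m ^ 3] points. *)
pose T : finType := ('I_m * 'I_(m ^ 2) * 'I_m)%type.
pose pt (u : T) := u.1.1 * u.2 + u.1.2.
pose arc (u v : T) := [&& u.2 < v.2, u.1 != v.1 & u.1.1 * v.2 + u.1.2 == pt v].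
pose e u v := arc u v || arc v u.
have tri (u v w : T) : arc u v -> arc u w -> arc v w -> False.
  move=> /and3P[uv nuv /eqP p1] /and3P[uw nuw /eqP p2] /and3P[vw nvw /eqP p3].
  have x23 : v.2 < w.2 := vw.
  have aa : u.1.1 = v.1.1 :> nat by rewrite /pt in p1 p2 p3; nia.
  have bb : u.1.2 = v.1.2 :> nat by rewrite /pt in p1; nia.
  case/eqP: nuv; rewrite [u.1]surjective_pairing [v.1]surjective_pairing.
  by congr (_, _); apply: val_inj.
have arc_lt u v : arc u v -> u.2 < v.2 by case/and3P.
have pt_lt u : pt u < 2 * m ^ 2.
  have := ltn_ord u.1.1; have := ltn_ord u.2; have := ltn_ord u.1.2.
  rewrite /pt mul2n -addnn => h1 h2 h3; apply: leq_ltn_trans (_ : m ^ 2 + u.1.2 < _).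
    by rewrite leq_add2r (leq_trans (leq_mul (ltnW h3) (ltnW h2))) // mulnn.
  by rewrite ltn_add2l.
apply: (@inverse_ramsey3_le T e setT).
- by move=> u v; rewrite /e orbC.
- by rewrite cardsT !card_prod !card_ord (leq_trans nm) // !expnS expn0; lia.
- move=> u v w _ _ _; rewrite /e; apply/negP => /and3P[].
  (* Of the eight orientations, the two cyclic ones contradict the order of the abscissas and the
     other six are transitive. *)
  case/orP=> uv; case/orP=> uw; case/orP=> vw.
  + exact: tri uv uw vw.
  + exact: tri uw uv vw.
  + by have := arc_lt _ _ uv; have := arc_lt _ _ uw; have := arc_lt _ _ vw; lia.
  + exact: tri uw vw uv.
  + exact: tri uv vw uw.
  + by have := arc_lt _ _ uv; have := arc_lt _ _ uw; have := arc_lt _ _ vw; lia.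
  + exact: tri vw uv uw.
  + exact: tri vw uw uv.
move=> S _ indS.
pose first (u : T) := [forall u' : T in S, (u'.1 == u.1) ==> (u.2 <= u'.2)].
pose S1 := [set u in S | first u].
rewrite -(cardsID S1) (_ : 3 * m ^ 3 = m ^ 3 + 2 * m ^ 3); last lia.
apply: leq_add.
  have inj1 : {in S :&: S1 &, injective (fun u : T => u.1)}.
    move=> u v; rewrite !inE => /and3P[uS _ /forall_inP fu] /and3P[vS _ /forall_inP fv] uv.
    have := fu _ vS; rewrite uv eqxx /= => le1.
    have := fv _ uS; rewrite uv eqxx /= => le2.
    rewrite [u]surjective_pairing [v]surjective_pairing uv; congr (_, _).
    by apply: val_inj; apply/eqP; rewrite eqn_leq le1 le2.
  rewrite -(card_in_imset inj1); apply: leq_trans (max_card _) _.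
  by rewrite card_prod !card_ord expnS.
have inj2 : {in S :\: S1 &, injective (fun u : T => (u.2, Ordinal (pt_lt u)))}.
  move=> u v; rewrite !inE negb_and => /andP[nu uS] /andP[_ vS] [x2 ptuv].
  move: nu; rewrite uS /= negb_forall => /existsP[u'].
  rewrite !negb_imply -ltnNge => /and3P[u'S /eqP u'u lt].
  rewrite [u]surjective_pairing [v]surjective_pairing x2; congr (_, _).
  apply/eqP; apply/negP => /negP nuv.
  (* An earlier flag [u'] on the line of [u] points to every flag of another line at the point of
     [u]. *)
  have arcuv : arc u' v by rewrite /arc -x2 lt u'u nuv /= -ptuv.
  have := indS u' v u'S vS; rewrite /e arcuv /=.
  have : u' != v by apply: contraTneq nuv => <-; rewrite u'u eqxx.
  by move=> -> /(_ isT).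
rewrite -(card_in_imset inj2); apply: leq_trans (max_card _) _.
by rewrite card_prod !card_ord (expnS m 2) mulnCA.
Qed.

Lemma edge_cliques (T : finType) (G : sgraph T) (U : {set T}) : alpha G < #|U| ->
  exists2 K, K \in cliques (adj G) 2 & K \subset U.
Proof.
move=> lt; have : ~~ independent G U by apply: contraTN lt => /leq_alpha; rewrite -leqNgt.
rewrite negb_forall => /existsP[x]; rewrite negb_imply => /andP[xU].
rewrite negb_forall => /existsP[y]; rewrite negb_imply negbK => /andP[yU xy].
have nxy : x != y by apply: contraTneq xy => ->; rewrite adj_irr.
exists [set x; y]; last by apply/subsetP => z; rewrite !inE => /orP[] /eqP->.
apply/cliquesP; split; first by rewrite cards2 nxy.
by move=> z t; rewrite !inE => /orP[] /eqP-> /orP[] /eqP->; rewrite ?eqxx // adjC.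
Qed.

Lemma alpha_gt0 (T : finType) (G : sgraph T) (x : T) : 0 < alpha G.
Proof.
rewrite -[1](cards1 x); apply: leq_alpha; apply/independentP => y z.
by rewrite !inE => /eqP-> /eqP->; rewrite adj_irr.
Qed.

(* k disjoint copies of the triangle-free graph induced on U. *)
Lemma inverse_ramsey3_copies n k (G : sgraph 'I_n) (U : {set 'I_n}) :
  (forall K, K \in cliques (adj G) 3 -> ~~ (K \subset U)) ->
  n <= k * #|U| -> inverse_ramsey 3 n <= k * alpha G.
Proof.
move=> noK nU.
pose e (u v : 'I_k * 'I_n) := (u.1 == v.1) && adj G u.2 v.2.
apply: (@inverse_ramsey3_le _ e (setX setT U)).
- by move=> u v; rewrite /e eq_sym adjC.
- by rewrite cardsX cardsT card_ord.
- move=> [i x] [j y] [l z]; rewrite !inE /= => xU yU zU.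
  apply/negP => /and3P[/andP[_ /= xy] /andP[_ /= xz] /andP[_ /= yz]].
  have [nxy nxz nyz] : [/\ x != y, x != z & y != z].
    by split; [move: xy | move: xz | move: yz]; apply: contraTneq => ->; rewrite adj_irr.
  have Kc : [set x; y; z] \in cliques (adj G) 3.
    apply/cliquesP; split.
      by rewrite setUC cardsU1 cards2 !inE ![z == _]eq_sym (negPf nxz) (negPf nyz) nxy.
    by move=> s t; rewrite !inE -!orbA => /or3P[] /eqP-> /or3P[] /eqP->; rewrite ?eqxx // adjC.
  case/negP: (noK _ Kc).
  by apply/subsetP => s; rewrite !inE -!orbA => /or3P[] /eqP->.
move=> S _ indS.
have := @card_fibers nat _ _ S; rewrite !natn => ->.
have -> : k * alpha G = \sum_(i < k) alpha G by rewrite sum_nat_const card_ord.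
apply: leq_sum => i _; rewrite natn.
apply: leq_alpha; apply/independentP => x y; rewrite !inE => xS yS.
have [->|nxy] := eqVneq x y; first by rewrite adj_irr.
have := indS _ _ xS yS; rewrite /e /= eqxx /=; apply.
by apply: contra nxy => /eqP[->].
Qed.

(** Each edge is the image of two ordered pairs. *)
Lemma double_edges_le (T : finType) (G : sgraph T) :
  2 * #|edges G| <= \sum_x \sum_y adj G x y.
Proof.
rewrite pair_big /= -big_mkcond /=.
rewrite (partition_big (fun p : T * T => [set p.1; p.2]) (mem (edges G))) //=.
rewrite mulnC -sum_nat_const; apply: leq_sum => s sG.
have /forall_inP/(_ _ sG)/cards2P[x [y [nxy sE]]] := edges_card2 G.
apply: (@leq_trans #|[set (x, y); (y, x)]|); first by rewrite cards2 xpair_eqE negb_and nxy.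
rewrite sum1dep_card; apply: subset_leq_card; apply/subsetP => p.
rewrite !inE /adj => /orP[] /eqP-> /=; last rewrite setUC.
  by rewrite -sE sG eqxx.
by rewrite -sE sG eqxx.
Qed.


(* Real exponents and the limit statement *)
From mathcomp Require Import all_classical all_reals all_analysis.
Import numFieldNormedType.Exports.

Local Open Scope ring_scope.

(** Verifies the hypotheses of [K9_free_edge_density] with [s] the 800th root of [n]: edges come
    from the flag bound on the independence number, triangles from disjoint copies. *)
Lemma K9_free_edges (R : realType) (gamma : R) : 0 < gamma ->
  exists2 delta : R, 0 < delta & exists N : nat, forall n (G : sgraph 'I_n),
    (N <= n)%N -> graph_free (complete_graph 9) G ->
    (alpha G)%:R <= delta * (inverse_ramsey 3 n)%:R ->
    #|edges G|%:R <= (3%:R / 10%:R + gamma) * n%:R ^+ 2.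
Proof.
move=> gamma0; have [kappa [n0 [kappa0 main]]] := K9_free_edge_density gamma0.
(* [k] copies of a set of [kappa * n] vertices have at least [n] vertices. *)
pose k := Num.bound kappa^-1.
have kk : 1 < k%:R * kappa.
  by rewrite -ltr_pdivrMr // mul1r archi_boundP // invr_ge0 ltW.
(* A triangle-free large set would give [(k + 1) * alpha G <= Q(3, n) <= k * alpha G], impossible as
   [alpha G >= 1]. *)
pose delta : R := k.+1%:R^-1.
have delta0 : 0 < delta by rewrite invr_gt0.
exists delta => //.
(* The term [26 ^+ 8] forces [u > 26], whence [(24 * u ^+ 6 + 1) + u ^+ 6 <= 26 * u ^+ 6 < u ^+
   7]. *)
exists (Num.bound (`|n0| + 26 ^+ 8)) => n G Nn GF aG.
have big : `|n0| + 26 ^+ 8 < n%:R.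
  apply: lt_le_trans (archi_boundP _) _; last by rewrite ler_nat.
  by rewrite addr_ge0 // exprn_ge0.
have n0n : n0 < n%:R.
  by apply: le_lt_trans (ler_norm _) _; apply: le_lt_trans big; rewrite lerDl exprn_ge0.
have n26 : 26 ^+ 8 < n%:R :> R by apply: le_lt_trans big; rewrite lerDr.
have np : 0 < n%:R :> R by apply: le_lt_trans n26; rewrite exprn_ge0.
pose s : R := n%:R `^ (100 * 8)%:R^-1.
have s0 : 0 < s by rewrite powR_gt0.
pose u := s ^+ 100.
have nE : n%:R = u ^+ 8.
  rewrite /u -exprM -powR_mulrn ?(ltW s0) // -powRrM.
  by rewrite mulVf ?pnatr_eq0 // powRr1 // ltW.
have u0 : 0 < u by rewrite exprn_gt0.
have u26 : 26 < u.
  rewrite ltNge; apply/negP => u26.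
  have : u ^+ 8 <= 26 ^+ 8 by rewrite lerXn2r ?nnegrE // ltW.
  by rewrite -nE leNgt n26.
(* An integer just above [u ^+ 2], the fourth root of [n]; as [m <= 2 * u ^+ 2], the flag bound
   [3 * m ^ 3] is at most [24 * u ^+ 6]. *)
pose m := (Num.truncn (u ^+ 2)).+1.
have um : u ^+ 2 < m%:R by apply: truncnS_gt.
have mu : m%:R <= 2 * u ^+ 2.
  have /andP[h _] := truncn_itv (sqr_ge0 u).
  have : 1 <= u ^+ 2 by rewrite exprn_ege1 //; lra.
  by rewrite /m -natr1; lra.
have nm : (n <= m ^ 4)%N.
  rewrite -(ler_nat R) nE natrX (exprM u 2 4) lerXn2r ?nnegrE ?sqr_ge0 //.
  exact: ltW.
have Qm := inverse_ramsey3_flags nm.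
have a6 : (alpha G)%:R <= 24 * u ^+ 6.
  apply: le_trans aG _; apply: (@le_trans _ _ (inverse_ramsey 3 n)%:R).
    by rewrite ler_piMl // invf_le1 // ler1n.
  apply: (@le_trans _ _ (3 * m ^ 3)%N%:R); first by rewrite ler_nat.
  rewrite natrM natrX.
  have : m%:R ^+ 3 <= (2 * u ^+ 2) ^+ 3 by rewrite lerXn2r ?nnegrE // mulr_ge0 // sqr_ge0.
  have -> : (2 * u ^+ 2) ^+ 3 = 8 * u ^+ 6 by ring.
  by lra.
have gap : (alpha G).+1%:R + u ^+ 6 < u ^+ 7.
  have h1 : 1 <= u ^+ 6 by rewrite exprn_ege1 //; lra.
  have h2 : 26 * u ^+ 6 < u ^+ 7 by rewrite [u ^+ 7]exprS ltr_pM2r // exprn_gt0.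
  by rewrite -natr1; lra.
have noK9 K : K \notin cliques (adj G) 9.
  by apply: contra GF; apply: cliques_contains.
have n_gt0 : (0 < n)%N by rewrite -(ltr0n R).
have := main _ (adj G) s (alpha G).+1%:R (@adjC _ G) (@adj_irr _ G) s0.
rewrite card_ord => /(_ nE n0n gap).
have edge_in (U : {set 'I_n}) : (alpha G).+1%:R <= #|U|%:R :> R ->
    exists2 K, K \in cliques (adj G) 2 & K \subset U.
  by rewrite ler_nat; apply: edge_cliques.
have triangle_in (U : {set 'I_n}) : kappa * n%:R <= #|U|%:R ->
    exists2 K, K \in cliques (adj G) 3 & K \subset U.
  move=> bigU.
  have [/exists_inP[K Kc KU]|] := boolP [exists K in cliques (adj G) 3, K \subset U].
    by exists K.
  rewrite negb_exists => /forallP noK; exfalso.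
  have nU : (n <= k * #|U|)%N.
    rewrite -(ler_nat R) natrM; apply: (@le_trans _ _ (k%:R * (kappa * n%:R))).
      by rewrite mulrA ler_peMl // ltW.
    by rewrite ler_wpM2l.
  have Qk := @inverse_ramsey3_copies n k G U _ nU.
  have {Qk} : (inverse_ramsey 3 n <= k * alpha G)%N.
    by apply: Qk => K Kc; have := noK K; rewrite Kc.
  rewrite -(ler_nat R) natrM => Qk.
  have a1 : 1 <= (alpha G)%:R :> R by rewrite ler1n (alpha_gt0 G (Ordinal n_gt0)).
  have : (alpha G)%:R * k.+1%:R <= (inverse_ramsey 3 n)%:R :> R.
    by rewrite -ler_pdivlMr // mulrC.
  by move: Qk; rewrite -natr1; lra.
move=> /(_ edge_in triangle_in noK9).
have := double_edges_le G; rewrite -(ler_nat R) natrM natr_sum.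
under eq_bigr do rewrite natr_sum.
by lra.
Qed.

(** The condition [0 <= c] covers the value [0] of an empty maximum. *)
Lemma ramsey_turan_le (R : realType) (U : finType) (H : sgraph U) n (a c : R) : 0 <= c ->
  (forall G : sgraph 'I_n, graph_free H G -> (alpha G)%:R <= a -> #|edges G|%:R <= c) ->
  (ramsey_turan n H a)%:R <= c.
Proof.
move=> c0 h; rewrite /ramsey_turan.
apply: (big_ind (fun x : nat => x%:R <= c)) => // [x y xc yc|G /andP[HG aG]].
  by case: (leqP x y) => _.
exact: h.
Qed.

Lemma ramsey_turan_mono (R : realType) (U : finType) (H : sgraph U) n (a b : R) : a <= b ->
  (ramsey_turan n H a <= ramsey_turan n H b)%N.
Proof.
move=> ab; apply/bigmax_leqP => G /andP[HG aG].
by apply: leq_bigmax_cond; rewrite HG (le_trans aG).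
Qed.

Lemma limn_esup_mono (R : realType) (u v : nat -> \bar R) :
  (forall n, (u n <= v n)%E) -> (limn_esup u <= limn_esup v)%E.
Proof.
move=> uv; rewrite !limn_esup_lim; apply: lee_lim; [exact: is_cvg_esups..|].
apply: nearW => n; apply: ge_ereal_sup => _ [i /= ni <-].
by apply: le_trans (uv i) _; apply: ereal_sup_ubound; exists i.
Qed.

Lemma limn_esup_le (R : realType) (u : nat -> \bar R) (c : \bar R) N :
  (forall n, (N <= n)%N -> (u n <= c)%E) -> (limn_esup u <= c)%E.
Proof.
move=> uc; rewrite limn_esup_lim; apply: lime_le; first exact: is_cvg_esups.
near=> n; apply: ge_ereal_sup => _ [i /= ni <-]; apply: uc.
by apply: leq_trans ni; near: n; exact: nbhs_infty_ge.
Unshelve. all: by end_near. Qed.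

Local Open Scope classical_set_scope.

Theorem theorem1p3 (R : realType) :
  rho_tau_o_le (complete_graph 9)
    (fun n => (inverse_ramsey 3 n)%:R : R) (3%:R / 10%:R) /\
  (forall gamma : R, 0 < gamma ->
     exists2 delta : R, 0 < delta &
       exists N : nat, forall (n : nat) (G : sgraph 'I_n),
         (N <= n)%N ->
         graph_free (complete_graph 9) G ->
         (alpha G)%:R <= delta * (inverse_ramsey 3 n)%:R ->
         #|edges G|%:R <= (3%:R / 10%:R + gamma) * n%:R ^+ 2).
Proof.
split; last exact: K9_free_edges.
set f := fun n => (inverse_ramsey 3 n)%:R : R.
pose F d := rho_tau_upper (complete_graph 9) (fun n => d * f n).
(* A larger [d] admits more graphs, so [F] is nondecreasing and its right limit at [0] exists as an
   infimum. *)
have mono : {in Interval (BRight (0 : R)) +oo%O &, {homo F : x y / x <= y >-> (x <= y)%E}}.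
  move=> x y _ _ xy; apply: limn_esup_mono => n.
  rewrite lee_fin ler_wpM2r ?invr_ge0 ?sqr_ge0 // ler_nat.
  by apply: ramsey_turan_mono; rewrite ler_wpM2r // ler0n.
exists (ereal_inf [set F x | x in [set` Interval (BRight (0 : R)) +oo%O]]).
  exact: nondecreasing_at_right_cvge mono.
apply/lee_addgt0Pr => gamma gamma0.
have [delta delta0 [N HN]] := K9_free_edges gamma0.
(* The infimum is at most the value at the [delta] belonging to [gamma]. *)
apply: ge_ereal_inf; exists (F delta).
  by exists delta => //=; rewrite in_itv /= andbT.
apply: (@limn_esup_le _ _ _ N) => n Nn; rewrite -EFinD lee_fin.
have c0 : 0 <= 3%:R / 10%:R + gamma by rewrite addr_ge0 ?divr_ge0 // ltW.
(* At [n = 0] the quotient is [0] by the convention on division by zero. *)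
have [->|n0] := posnP n; first by rewrite expr0n invr0 mulr0.
rewrite ler_pdivrMr ?exprn_gt0 ?ltr0n //.
apply: ramsey_turan_le; first by rewrite mulr_ge0 ?sqr_ge0.
by move=> G GF aG; apply: HN.
Qed.
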